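(* Let $X_1,X_2,\dots$ be i.i.d. with $\mathbf{E}X_1=-a<0$ and $\mathrm{Var}(X_1)<\infty$. Assume $\overline F(x)\sim e^{-g(x)}x^{-2}$ as $x\to\infty$, where $g:(0,\infty)\to\mathbb{R}$ is continuously differentiable, nondecreasing for all sufficiently large $x$, and such that $x\mapsto g(x)/x$ is nonincreasing on $(0,\infty)$ with $g(x)/x\to0$. Then: (i) there exists a constant $C>0$ such that for all sufficiently large $x$, \[ \mathbf{P}(A_\tau>x)\le Cx^{1/4}\exp\left\{-g(\sqrt{2ax})\sqrt{1-\frac{2Cg(\sqrt{2ax})}{a\sqrt{2ax}}}\right\}; \] (ii) for every $\varepsilon>0$ there exists $C>0$ such that \[ \liminf_{x\to\infty}\frac{\mathbf{P}(A_\tau>x)}{\overline F(\sqrt{2ax}+Cx^{1/4+\varepsilon})}\ge\mathbf{E}\tau; \] (iii) if moreover there is $\gamma_0\in(0,1)$ such that $x\mapsto g(x)/x^{\gamma_0}$ is nonincreasing on $(0,\infty)$ with $g(x)/x^{\gamma_0}\to0$, then \[ \lim_{x\to\infty}\frac{\ln\mathbf{P}(A_\tau>x)}{\ln\overline F(\sqrt{2ax})}=1. \]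
   Context: $S_0=0$, $S_n=X_1+\dots+X_n$, $\overline F(x)=\mathbf{P}(X_1>x)$, $\tau=\min\{n\ge1:S_n\le0\}$, $A_\tau=\sum_{k=0}^{\tau-1}S_k$. *)

(* Defs.v *)
From HB Require Import structures.
From mathcomp Require Import all_boot all_order all_algebra.
From mathcomp Require Import all_classical all_reals all_analysis.
Set Implicit Arguments. Unset Strict Implicit. Unset Printing Implicit Defensive.
Import Order.TTheory GRing.Theory Num.Theory.
Import numFieldNormedType.Exports.
Local Open Scope classical_set_scope.
Local Open Scope ring_scope.

Section Defs.
Context {d : measure_display} {T : measurableType d} {R : realType}.
Variable (P : probability T R).

(* X i is the (i+1)-th summand X_{i+1} of the paper. *)

Definition mutually_independent (X : nat -> {RV P >-> R}) : Prop :=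
  forall (I : seq nat) (B : nat -> set R), uniq I ->
    (forall i, measurable (B i)) ->
    P (\bigcap_(i in [set` I]) (X i @^-1` B i)) = (\prod_(i <- I) P (X i @^-1` B i))%E.

Definition identically_distributed (X : nat -> {RV P >-> R}) : Prop :=
  forall n (B : set R), measurable B -> distribution P (X n) B = distribution P (X 0) B.

Definition iid (X : nat -> {RV P >-> R}) : Prop :=
  mutually_independent X /\ identically_distributed X.

Definition Ssum (X : nat -> {RV P >-> R}) (n : nat) (w : T) : R :=
  \sum_(i < n) X i w.

Definition Fbar (X : nat -> {RV P >-> R}) (x : R) : R :=
  fine (P [set w | x < X 0 w]).

Definition tau_opt (X : nat -> {RV P >-> R}) (w : T) : option nat :=
  match pselect (exists n, (1 <= n)%N && (Ssum X n w <= 0)) with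
  | left h => Some (ex_minn h)
  | right _ => None
  end.

Definition tau (X : nat -> {RV P >-> R}) (w : T) : \bar R :=
  if tau_opt X w is Some n then (n%:R)%:E else +oo%E.

Definition Atau (X : nat -> {RV P >-> R}) (w : T) : \bar R :=
  if tau_opt X w is Some n then (\sum_(k < n) Ssum X k w)%:E else +oo%E.

Definition PAtau_gt (X : nat -> {RV P >-> R}) (x : R) : R :=
  fine (P [set w | (x%:E < Atau X w)%E]).

Definition Etau (X : nat -> {RV P >-> R}) : \bar R := (\int[P]_w tau X w)%E.

End Defs.

(* Main.v *)
Require Import Defs.
From mathcomp Require Import all_boot all_order all_algebra.
From mathcomp Require Import all_classical all_reals all_analysis.
From mathcomp Require Import measurable_realfun ring lra zify.
Import Order.TTheory GRing.Theory Num.Theory.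
Import numFieldNormedType.Exports.
Local Open Scope classical_set_scope.
Local Open Scope ring_scope.
Set Implicit Arguments. Unset Strict Implicit. Unset Printing Implicit Defensive.

(** Write [y = sqrt (2 a x)]: a jump to height [y] followed by a descent at speed [a]
    sweeps the area [y ^ 2 / (2 a) = x].

    Upper bound. As [g t / t] decreases, [e ^ (l t) Fbar t <= 2 / t ^ 2] for
    [l <= g y / y] and [t <= y], so the exponential moment of an increment truncated at
    [y] is at most [exp (- a l + C l ^ 2)].  The area of an excursion of length about [N]
    is at most [sum_i (N - 1 - i) X_i]; tilting the [i]-th increment by
    [(lam / N) (N - 1 - i)] with [lam = g y / y] bounds its tail by
    [exp (- lam (x / N + a N / 2 - C lam N))], which is minimised over [N] by the
    inequality of arithmetic and geometric means.  A maximal inequality treats all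
    lengths in a window of width of order [x ^ (1/4)] at once at the cost of a constant,
    whence the factor [x ^ (1/4)].

    Lower bound. A jump above [y + 2 x ^ (1/4 + eps)] before [tau], followed by
    fluctuations below [x ^ (1/4 + eps)] around the drift (Kolmogorov's maximal
    inequality), forces [A_tau > x]; the times at which this jump may occur contribute
    [sum_k P (tau > k) = E tau].

    Logarithmic asymptotics. If [g y] is much larger than [ln y], the upper bound above
    suffices.  Otherwise its polynomial prefactor matters: the excursion is then cut at
    its first jump larger than a small multiple of [y].  Before that jump the walk stays
    low up to a polynomially negligible event, the jump occurs before [tau] (which costs
    only [sum_k P (tau > k) = O (ln y)]), and the tilted bound applies after it. *)

(** * Probabilities as real numbers *)

Lemma eq_implies_le disp (T : porderType disp) (x y : T) : x = y -> (x <= y)%O.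
Proof. by move->. Qed.

Lemma sum_ord_le (R : numDomainType) n (F : nat -> R) (c : R) :
  (forall i, (i < n)%N -> F i <= c) -> \sum_(i < n) F i <= n%:R * c.
Proof.
move=> Fc; rewrite mulr_natl -[X in _ *+ X]card_ord -sumr_const.
by apply: ler_sum => i _; exact: Fc.
Qed.

Lemma grid_cell (R : realFieldType) (h s : R) n : 0 < s <= n%:R * h ->
  exists2 l, (l < n)%N & l%:R * h < s <= l.+1%:R * h.
Proof.
elim: n => [|n IH] /andP[s0 sn]; first by move: sn; rewrite mul0r; lra.
have [ns|ns] := ltP (n%:R * h) s; first by exists n => //; rewrite ns.
by have [|l ln sl] := IH _; [rewrite s0|exists l => //; exact: ltnW].
Qed.

Section MeasurableComparisons.
Context {d : measure_display} {T : measurableType d} {R : realType}.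
Variables f g : T -> R.
Hypotheses (mf : measurable_fun setT f) (mg : measurable_fun setT g).

Lemma measurable_ltr_set : measurable [set w | f w < g w].
Proof.
have := measurable_fun_ltr mf mg measurableT (Y := [set true]).
by rewrite setTI; apply.
Qed.

Lemma measurable_ler_set : measurable [set w | f w <= g w].
Proof.
have := measurable_fun_ler mf mg measurableT (Y := [set true]).
by rewrite setTI; apply.
Qed.

End MeasurableComparisons.

Section Probabilities.
Context {d : measure_display} {T : measurableType d} {R : realType}.
Variable (P : probability T R).
Implicit Types (A B C : set T).

Definition pr (E : set T) : R := fine (P E).

Lemma prE A : measurable A -> P A = (pr A)%:E.
Proof. by move=> mA; rewrite /pr fineK// fin_num_measure. Qed.

Lemma pr_ge0 A : 0 <= pr A.
Proof. by rewrite /pr fine_ge0. Qed.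

Lemma pr_setT : pr setT = 1.
Proof. by rewrite /pr probability_setT. Qed.

Lemma pr_le1 A : measurable A -> pr A <= 1.
Proof. by move=> mA; rewrite -lee_fin -prE// probability_le1. Qed.

Lemma pr_le A B : measurable A -> measurable B -> A `<=` B -> pr A <= pr B.
Proof. by move=> mA mB AB; rewrite -lee_fin -!prE// le_measure// inE. Qed.

Lemma pr_setC A : measurable A -> pr (~` A) = 1 - pr A.
Proof.
move=> mA; apply: EFin_inj; rewrite -prE ?EFinB -?prE//; last exact: measurableC.
exact: probability_setC.
Qed.

Lemma pr_leU A B C : measurable A -> measurable B -> measurable C ->
  A `<=` B `|` C -> pr A <= pr B + pr C.
Proof.
move=> mA mB mC ABC; have mU := measurableU _ _ mB mC.
apply: le_trans (pr_le mA mU ABC) _.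
by rewrite -lee_fin EFinD -!prE// measureU2.
Qed.

Lemma pr_le_sum n (F : nat -> set T) A : measurable A -> (forall i, measurable (F i)) ->
  A `<=` \bigcup_(i < n) F i -> pr A <= \sum_(i < n) pr (F i).
Proof.
move=> mA mF AF; rewrite -lee_fin -prE// -sumEFin.
under eq_bigr do rewrite -prE//.
by apply: content_subadditive => //; rewrite -bigcup_mkord.
Qed.

Lemma pr_le_natmul n (F : nat -> set T) A (c : R) : measurable A ->
  (forall i, measurable (F i)) -> A `<=` \bigcup_(i < n) F i ->
  (forall i, (i < n)%N -> pr (F i) <= c) -> pr A <= n%:R * c.
Proof.
move=> mA mF AF Fc; apply: le_trans (pr_le_sum mA mF AF) _.
exact: (sum_ord_le (F := fun i => pr (F i))).
Qed.

Lemma pr_sum_le n (F : nat -> set T) A : measurable A -> (forall i, measurable (F i)) ->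
  trivIset `I_n F -> \bigcup_(i < n) F i `<=` A -> \sum_(i < n) pr (F i) <= pr A.
Proof.
move=> mA mF tF FA; rewrite -lee_fin -prE// -sumEFin.
under eq_bigr do rewrite -prE//.
have mU : measurable (\big[setU/set0]_(i < n) F i) by exact: bigsetU_measurable.
rewrite -measure_semi_additive_ord_I//.
by apply: le_measure; rewrite ?inE// -bigcup_mkord.
Qed.

Lemma pr_markov (f : T -> R) (L M : R) : measurable_fun setT f -> 0 < L ->
  (forall w, 0 <= f w) -> (\int[P]_w (f w)%:E <= M%:E)%E ->
  pr [set w | L <= f w] <= M / L.
Proof.
move=> mf L0 f0 fM; rewrite ler_pdivlMr// mulrC -lee_fin EFinM.
rewrite -prE; last exact: measurable_ler_set.
apply: le_trans fM.
have := @markov _ _ _ P (mfun_Sub (mem_set mf)) id L L0 (@measurable_id _ _ setT)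
  (fun r r0 => r0) (fun x y _ _ xy => xy).
rewrite unlock /=.
under [X in (_ * P X <= _)%E]eq_set do rewrite lee_fin ger0_norm//.
by under eq_integral do rewrite /= ger0_norm//.
Qed.

Lemma integral_constant (r : R) : (\int[P]_w r%:E = r%:E)%E.
Proof. by rewrite integral_cst//= probability_setT mule1. Qed.

End Probabilities.

(** * Independence of blocks of increments *)

Section SigmaEvents.
Context {d : measure_display} {T : measurableType d} {R : realType} {P : probability T R}.
Implicit Types (X : nat -> {RV P >-> R}) (I J : set nat) (A B E : set T).

Definition generators X I : set (set T) :=
  [set E | exists2 i, I i & exists2 B, measurable B & E = X i @^-1` B].

Definition sigma_event X I E := <<s generators X I >> E.

Definition adapted X I (f : T -> R) :=
  measurable_fun [set: g_sigma_algebraType (generators X I)]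
    (f : g_sigma_algebraType (generators X I) -> R).

Lemma sigma_event_measurable X I E : sigma_event X I E -> measurable E.
Proof.
apply: smallest_sub; first exact: sigma_algebra_measurable.
by move=> _ [i _ [B mB ->]]; exact: measurable_funPTI.
Qed.

Lemma sub_sigma_event X I J E : I `<=` J -> sigma_event X I E -> sigma_event X J E.
Proof.
move=> IJ; apply: sub_smallest2r; first exact: smallest_sigma_algebra.
by move=> _ [i Ii [B mB ->]]; exists i; [exact: IJ|exists B].
Qed.

Lemma sigma_eventT X I : sigma_event X I setT.
Proof. exact: (@measurableT _ (g_sigma_algebraType (generators X I))). Qed.

Lemma sigma_eventI X I A B :
  sigma_event X I A -> sigma_event X I B -> sigma_event X I (A `&` B).
Proof. exact: (@measurableI _ (g_sigma_algebraType (generators X I))). Qed.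

Lemma sigma_eventU X I A B :
  sigma_event X I A -> sigma_event X I B -> sigma_event X I (A `|` B).
Proof. exact: (@measurableU _ (g_sigma_algebraType (generators X I))). Qed.

Lemma sigma_event_bigcap X I n (F : nat -> set T) :
  (forall i, (i < n)%N -> sigma_event X I (F i)) -> sigma_event X I (\bigcap_(i < n) F i).
Proof.
apply: (@fin_bigcap_measurable _ (g_sigma_algebraType (generators X I))).
exact: finite_II.
Qed.

Lemma sigma_event_bigcup X I n (F : nat -> set T) :
  (forall i, (i < n)%N -> sigma_event X I (F i)) -> sigma_event X I (\bigcup_(i < n) F i).
Proof.
apply: (@fin_bigcup_measurable _ (g_sigma_algebraType (generators X I))).
exact: finite_II.
Qed.

Lemma sigma_event_preimage X I f (B : set R) :
  adapted X I f -> measurable B -> sigma_event X I (f @^-1` B).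
Proof. by move=> mf mB; rewrite -[f @^-1` B]setTI; exact: mf. Qed.

Lemma sigma_event_ltr X I (f g : T -> R) :
  adapted X I f -> adapted X I g -> sigma_event X I [set w | f w < g w].
Proof. exact: (@measurable_ltr_set _ (g_sigma_algebraType (generators X I))). Qed.

Lemma sigma_event_ler X I (f g : T -> R) :
  adapted X I f -> adapted X I g -> sigma_event X I [set w | f w <= g w].
Proof. exact: (@measurable_ler_set _ (g_sigma_algebraType (generators X I))). Qed.

Lemma adapted_measurable X I f : adapted X I f -> measurable_fun setT f.
Proof.
move=> mf _ B mB; rewrite setTI.
exact: sigma_event_measurable (sigma_event_preimage mf mB).
Qed.

Lemma sub_adapted X I J f : I `<=` J -> adapted X I f -> adapted X J f.
Proof.
move=> IJ aI _ B mB; rewrite setTI.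
exact: sub_sigma_event IJ (sigma_event_preimage aI mB).
Qed.

Lemma adapted_increment X I i : I i -> adapted X I (X i).
Proof.
move=> Ii _ B mB; rewrite setTI; apply: sub_sigma_algebra.
by exists i => //; exists B.
Qed.

Lemma adapted_cst X I (r : R) : adapted X I (fun=> r).
Proof. exact: measurable_cst. Qed.

Lemma adapted_sum X I n (f : nat -> T -> R) : (forall i, (i < n)%N -> adapted X I (f i)) ->
  adapted X I (fun w => \sum_(i < n) f i w).
Proof.
elim: n => [|n IH] mf.
  by under [X in adapted _ _ X]eq_fun do rewrite big_ord0; exact: adapted_cst.
under [X in adapted _ _ X]eq_fun do rewrite big_ord_recr.
apply: measurable_funD; last exact: mf.
by apply: IH => i ni; apply: mf; rewrite ltnS ltnW.
Qed.

End SigmaEvents.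

Section Independence.
Context {d : measure_display} {T : measurableType d} {R : realType} {P : probability T R}.
Implicit Types (X : nat -> {RV P >-> R}) (I J : set nat).

Definition cylinders X I : set (set T) :=
  [set E | exists s (B : nat -> set R), [/\ uniq s, (forall i, i \in s -> I i),
     (forall i, measurable (B i)) & E = \bigcap_(i in [set` s]) (X i @^-1` B i)]].

Lemma cylinders_measurable X I : cylinders X I `<=` measurable.
Proof.
move=> _ [s [B [_ _ mB ->]]]; apply: fin_bigcap_measurable => [|i _].
  exact: finite_seq.
exact: measurable_funPTI.
Qed.

Lemma cylinders_setT X I : cylinders X I setT.
Proof.
exists [::], (fun=> setT); split => //.
by apply/seteqP; split.
Qed.

Lemma cylinders_setI X I : setI_closed (cylinders X I).
Proof.
move=> _ _ [s [B [us sI mB ->]]] [t [C [ut tI mC ->]]].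
exists (undup (s ++ t)), (fun i => (if i \in s then B i else setT) `&`
  (if i \in t then C i else setT)); split.
- exact: undup_uniq.
- by move=> i; rewrite mem_undup mem_cat => /orP[/sI|/tI].
- by move=> i; apply: measurableI; case: ifP.
- apply/seteqP; split=> [w [/= sw tw] i /= _|w /= stw].
    by split; case: ifPn => // ?; [exact: sw|exact: tw].
  split=> i /= ii; have /= := stw i; rewrite mem_undup mem_cat ii ?orbT => /(_ isT)[].
    by [].
  by [].
Qed.

Lemma sigma_event_cylinders X I A : sigma_event X I A -> <<s cylinders X I >> A.
Proof.
apply: sub_smallest2r; first exact: smallest_sigma_algebra.
move=> _ [i Ii [B mB ->]]; exists [:: i], (fun _ => B); split => //.
  by move=> j; rewrite inE => /eqP ->.
apply/seteqP; split=> [w Bw j /=|w /(_ i)]; last by apply; rewrite /= inE.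
by rewrite inE => /eqP ->.
Qed.

Lemma product_rule_extend (G : set (set T)) (C : set T) :
  G `<=` measurable -> setI_closed G -> G setT -> measurable C ->
  (forall A, G A -> P (A `&` C) = (P A * P C)%E) ->
  forall A, <<s G >> A -> P (A `&` C) = (P A * P C)%E.
Proof.
move=> Gm GI GT mC GC A sA.
have PC0 : 0 <= fine (P C) by rewrite fine_ge0.
have cover : \bigcup_(_ : nat) [set: T] = setT by apply/seteqP; split => // w _; exists 0%N.
have PCE : (fine (P C))%:E = P C by rewrite fineK// fin_num_measure.
have scaleE B : mscale (NngNum PC0) P B = (P B * P C)%E.
  by rewrite /mscale [X in (X * _)%E]PCE muleC.
rewrite -scaleE -[LHS]/(mrestr P mC A).
apply: (@g_sigma_algebra_measure_unique _ _ _ G Gm (fun=> setT) (fun=> GT) cover) => //.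
- by move=> B GB; rewrite [RHS]scaleE -GC.
- by move=> _; rewrite /= /mrestr setTI ltey_eq fin_num_measure.
Qed.

Lemma cylinders_independent X I J : mutually_independent X -> I `&` J = set0 ->
  forall A B, cylinders X I A -> cylinders X J B -> P (A `&` B) = (P A * P B)%E.
Proof.
move=> iX IJ _ _ [s [B [us sI mB ->]]] [t [C [ut tI mC ->]]].
have disj i : i \in s -> i \in t -> False.
  by move=> /sI Ii /tI Ji; have : (I `&` J) i by []; rewrite IJ.
pose D i := if i \in s then B i else C i.
have mD i : measurable (D i) by rewrite /D; case: ifP.
have := iX (s ++ t) D.
rewrite cat_uniq us ut /= andbT => /(_ _ mD) stP.
have -> : (\bigcap_(i in [set` s]) X i @^-1` B i) `&` (\bigcap_(i in [set` t]) X i @^-1` C i)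
   = \bigcap_(i in [set` (s ++ t)]) (X i @^-1` D i).
  apply/seteqP; split=> [w [/= sw tw] i /=|w /= stw].
    rewrite mem_cat /D => /orP[is_|it]; first by rewrite is_; exact: sw.
    by case: ifPn => [/disj/(_ it)//|_]; exact: tw.
  split=> i /= ii; have /= := stw i; rewrite mem_cat ii ?orbT => /(_ isT); rewrite /D.
    by rewrite ii.
  by case: ifPn => // /disj/(_ ii).
rewrite stP; last by apply/hasPn => i it; apply/negP => /disj/(_ it).
rewrite big_cat /= iX// iX//; congr (_ * _)%E; rewrite big_seq [RHS]big_seq;
  apply: eq_bigr => i ii; rewrite /D ?ii//.
by case: ifPn => // /disj/(_ ii).
Qed.

Lemma sigma_event_independent X I J : mutually_independent X -> I `&` J = set0 ->
  forall A B, sigma_event X I A -> sigma_event X J B -> P (A `&` B) = (P A * P B)%E.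
Proof.
move=> iX IJ A B sA sB.
apply: (product_rule_extend (@cylinders_measurable X I)) => //.
- exact: cylinders_setI.
- exact: cylinders_setT.
- exact: sigma_event_measurable sB.
- move=> C IC; rewrite setIC muleC.
  apply: (product_rule_extend (@cylinders_measurable X J)) => //.
  + exact: cylinders_setI.
  + exact: cylinders_setT.
  + exact: cylinders_measurable IC.
  + by move=> D JD; rewrite setIC muleC; exact: (cylinders_independent iX IJ).
  + exact: sigma_event_cylinders.
- exact: sigma_event_cylinders.
Qed.

Lemma pr_independent X I J A B : mutually_independent X -> I `&` J = set0 ->
  sigma_event X I A -> sigma_event X J B -> pr P (A `&` B) = pr P A * pr P B.
Proof.
move=> iX IJ sA sB; have mA := sigma_event_measurable sA.
have mB := sigma_event_measurable sB; apply: EFin_inj.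
by rewrite EFinM -!prE//; [exact: sigma_event_independent IJ _ _ sA sB|exact: measurableI].
Qed.

Lemma independent_integral X I J (U V : T -> R) (f : R * R -> \bar R) :
  mutually_independent X -> I `&` J = set0 -> adapted X I U -> adapted X J V ->
  measurable_fun setT f -> (forall z, (0 <= f z)%E) ->
  (\int[P]_w f (U w, V w) = \int[P]_w \int[P]_v f (U w, V v))%E.
Proof.
move=> iX IJ aU aV mf f0.
have mU := adapted_measurable aU; have mV := adapted_measurable aV.
pose U' := mfun_Sub (mem_set mU); pose V' := mfun_Sub (mem_set mV).
have mUV : measurable_fun setT (fun w => (U w, V w)) by exact: measurable_fun_pair.
pose UV' := mfun_Sub (mem_set mUV).
transitivity (\int[distribution P UV']_z f z)%E.
  by rewrite ge0_integral_distribution.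
transitivity (\int[(distribution P U' \x distribution P V')%E]_z f z)%E.
  apply: eq_measure_integral => A mA _; apply/esym.
  apply: product_measure_unique => // B C mB mC.
  rewrite /distribution /= /pushforward /=.
  apply: (sigma_event_independent iX IJ); exact: sigma_event_preimage.
rewrite fubini_tonelli1// ge0_integral_distribution//; last first.
- by move=> z; apply: integral_ge0.
- exact: measurable_fun_fubini_tonelli_F.
apply: eq_integral => w _ /=; rewrite /fubini_F ge0_integral_distribution//.
exact: measurableT_comp.
Qed.

End Independence.

(** * A maximal inequality *)

Section MaximalInequality.
Context {d : measure_display} {T : measurableType d} {R : realType} {P : probability T R}.
Implicit Types (X : nat -> {RV P >-> R}) (step : nat -> R -> R -> R) (V : R -> R).

Fixpoint chain X step (v0 : R) n (w : T) : R :=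
  if n is m.+1 then step m (chain X step v0 m w) (X m w) else v0.

Definition stop_at V (L : R) step : nat -> R -> R -> R :=
  fun m v x => if L <= V v then v else step m v x.

Lemma measurable_stop_at V L step m : measurable_fun setT V ->
  measurable_fun setT (fun z : R * R => step m z.1 z.2) ->
  measurable_fun setT (fun z : R * R => stop_at V L step m z.1 z.2).
Proof.
move=> mV ms; apply: measurable_fun_ifT => //.
by apply: measurable_fun_ler => //; apply: measurableT_comp => //; exact: measurable_fst.
Qed.

Lemma chain_adapted X step v0 n :
  (forall m, measurable_fun setT (fun z : R * R => step m z.1 z.2)) ->
  adapted X `I_n (chain X step v0 n).
Proof.
move=> ms; elim: n => [|n IH]; first exact: adapted_cst.
have past_n : adapted X `I_n.+1 (chain X step v0 n) by apply: sub_adapted IH => k /=; lia.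
have Xn : adapted X `I_n.+1 (X n) by apply: adapted_increment => /=.
exact: (measurableT_comp (ms n) (measurable_fun_pair past_n Xn)).
Qed.

Lemma integral_chain_le X step V (v0 c : R) n : mutually_independent X ->
  measurable_fun setT V -> (forall v, 0 <= V v) -> 0 <= c ->
  (forall m, measurable_fun setT (fun z : R * R => step m z.1 z.2)) ->
  (forall m v, (m < n)%N -> (\int[P]_w (V (step m v (X m w)))%:E <= (V v + c)%:E)%E) ->
  (\int[P]_w (V (chain X step v0 n w))%:E <= (V v0 + n%:R * c)%:E)%E.
Proof.
move=> iX mV V0 c0 ms; elim: n => [|n IH] drift.
  by rewrite mul0r addr0 /= integral_constant.
pose f (z : R * R) := (V (step n z.1 z.2))%:E.
have mf : measurable_fun setT f by apply/measurable_EFinP; exact: measurableT_comp.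
have f0 z : (0 <= f z)%E by rewrite lee_fin.
have mU : measurable_fun setT (chain X step v0 n) := adapted_measurable (chain_adapted v0 ms).
have disj : `I_n `&` [set n] = set0.
  by apply/seteqP; split=> // k [/= kn ek]; move: kn; rewrite ek ltnn.
rewrite [leLHS](@independent_integral _ _ _ _ X _ _ (chain X step v0 n) (X n) f iX disj)//.
- apply: (@le_trans _ _ (\int[P]_w ((V (chain X step v0 n w))%:E + c%:E))%E).
    apply: ge0_le_integral => //.
    + by move=> w _; apply: integral_ge0.
    + apply: (@measurableT_comp _ _ _ _ _ _ (fun u => \int[P]_v f (u, X n v))%E) => //.
      apply: (@measurable_fun_fubini_tonelli_F _ _ _ _ _ P (fun z => f (z.1, X n z.2))) => //.
      apply: measurableT_comp => //; apply: measurable_fun_pair; first exact: measurable_fst.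
      by apply: measurableT_comp => //; exact: measurable_snd.
    + by apply: emeasurable_funD => //; apply/measurable_EFinP; exact: measurableT_comp.
    + by move=> w _; rewrite -EFinD; exact: drift.
  rewrite ge0_integralD//; last 2 first.
  + by move=> w _; rewrite lee_fin.
  + by apply/measurable_EFinP; exact: measurableT_comp.
  rewrite integral_constant -natr1 mulrDl mul1r addrA EFinD leeD2r// IH// => m v mn.
  by apply: drift; rewrite ltnS ltnW.
- exact: chain_adapted.
- exact: adapted_increment.
Qed.

Lemma chain_stop_at X step V (v0 L : R) m n w : (m <= n)%N ->
  L <= V (chain X step v0 m w) -> L <= V (chain X (stop_at V L step) v0 n w).
Proof.
pose Z := chain X (stop_at V L step) v0.
have reached_or_equal k : L <= V (Z k w) \/ Z k w = chain X step v0 k w.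
  elim: k => [|k IH]; first by right.
  rewrite /Z /= -/(Z k) /stop_at; case: ifPn => [|Lk]; first by left.
  case: IH => [|->]; first by rewrite (negPf Lk).
  by right.
move=> /subnK <- Lm; elim: (n - m)%N => [|k IH] /=.
  by have [//|Zm] := reached_or_equal m; rewrite -/(Z m w) Zm.
by rewrite {1}/stop_at IH.
Qed.

(** Stopping when [V] first reaches [L] turns Markov's inequality at time [n] into a
    bound on the whole trajectory. *)
Lemma pr_max_chain X step V (v0 c L : R) n (E : set T) : mutually_independent X ->
  measurable_fun setT V -> (forall v, 0 <= V v) -> 0 <= c ->
  (forall m, measurable_fun setT (fun z : R * R => step m z.1 z.2)) ->
  (forall m v, (m < n)%N -> (\int[P]_w (V (step m v (X m w)))%:E <= (V v + c)%:E)%E) ->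
  0 < L -> measurable E ->
  (forall w, E w -> exists2 m, (m <= n)%N & L <= V (chain X step v0 m w)) ->
  pr P E <= (V v0 + n%:R * c) / L.
Proof.
move=> iX mV V0 c0 ms drift L0 mE sub.
have ms' m := measurable_stop_at L mV (ms m).
have mZ : measurable_fun setT (V \o chain X (stop_at V L step) v0 n).
  by apply: measurableT_comp => //; exact: adapted_measurable (chain_adapted _ ms').
apply: (@le_trans _ _ (pr P [set w | L <= V (chain X (stop_at V L step) v0 n w)])).
  apply: pr_le => //; first exact: measurable_ler_set.
  by move=> w /sub[m mn]; exact: chain_stop_at.
apply: pr_markov => //; apply: integral_chain_le => // m v mn.
rewrite /stop_at; case: (L <= V v); last exact: drift.
by rewrite integral_constant lee_fin lerDl.
Qed.

Lemma pr_max_prod X (phi : nat -> R -> R) (L : R) n (E : set T) :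
  mutually_independent X -> (forall i, measurable_fun setT (phi i)) ->
  (forall i x, 0 <= phi i x) ->
  (forall i, (i < n)%N -> (\int[P]_w (phi i (X i w))%:E <= 1)%E) ->
  0 < L -> measurable E ->
  (forall w, E w -> exists2 m, (m <= n)%N & L <= \prod_(i < m) phi i (X i w)) ->
  pr P E <= L^-1.
Proof.
move=> iX mphi phi0 mean L0 mE sub.
have prod_chain m w :
    chain X (fun i v x => v * phi i x) 1 m w = \prod_(i < m) phi i (X i w).
  by elim: m => [|m IH] /=; rewrite ?big_ord0// big_ord_recr /= IH.
suff : pr P E <= (`|1| + n%:R * 0) / L by rewrite mulr0 addr0 normr1 mul1r.
apply: (@pr_max_chain X (fun i v x => v * phi i x) Num.norm) => //.
- move=> m; apply: measurable_funM; first exact: measurable_fst.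
  by apply: measurableT_comp => //; exact: measurable_snd.
- move=> m v mn; under eq_integral do rewrite normrM (ger0_norm (phi0 _ _)) EFinM.
  rewrite ge0_integralZl ?lee_fin//; last 2 first.
  + by apply/measurable_EFinP; exact: measurableT_comp.
  + by move=> w _; rewrite lee_fin.
  by rewrite addr0 -[leRHS]mule1 lee_wpmul2l ?lee_fin//; exact: mean.
- move=> w /sub[m mn Lm]; exists m => //; rewrite prod_chain.
  exact: le_trans Lm (ler_norm _).
Qed.

Lemma kolmogorov_inequality X (a s2 L : R) n (E : set T) :
  mutually_independent X -> 0 <= s2 ->
  (forall i u, (\int[P]_w ((u + (X i w + a)) ^+ 2)%:E <= (u ^+ 2 + s2)%:E)%E) ->
  0 < L -> measurable E ->
  (forall w, E w -> exists2 m, (m <= n)%N & L <= `|Ssum X m w + m%:R * a|) ->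
  pr P E <= n%:R * s2 / L ^+ 2.
Proof.
move=> iX s20 drift L0 mE sub.
have walk_chain m w : chain X (fun _ v x => v + (x + a)) 0 m w = Ssum X m w + m%:R * a.
  elim: m => [|m IH] /=; first by rewrite /Ssum big_ord0 mul0r addr0.
  by rewrite IH /Ssum big_ord_recr /= -natr1; ring.
suff : pr P E <= (0 ^+ 2 + n%:R * s2) / L ^+ 2 by rewrite expr0n add0r.
apply: (@pr_max_chain X (fun _ v x => v + (x + a)) (fun v => v ^+ 2)) => //.
- by move=> v; exact: sqr_ge0.
- by move=> m; apply: measurable_funD => //; exact: measurable_funD.
- by rewrite exprn_gt0.
- move=> w /sub[m mn Lm]; exists m => //; rewrite walk_chain -[leRHS]real_normK ?num_real//.
  by rewrite ler_pXn2r ?nnegrE ?(ltW L0).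
Qed.

End MaximalInequality.

(** * Excursions *)

Section Walk.
Context {d : measure_display} {T : measurableType d} {R : realType} {P : probability T R}.
Implicit Types (X : nat -> {RV P >-> R}) (I J : set nat).

Definition shifted X k : nat -> {RV P >-> R} := fun i => X (k + i)%N.

Definition jump X (y : R) i : set T := [set w | y < X i w].

Definition no_jump X (y : R) n : set T := [set w | forall i, (i < n)%N -> X i w <= y].

Definition positive_until X n : set T :=
  [set w | forall k, (k < n)%N -> 0 < Ssum X k.+1 w].

Definition small_fluctuation X (a L : R) m : set T :=
  [set w | forall j, (j < m.+1)%N -> `|Ssum X j w + j%:R * a| < L].

Definition area X (v : R) n (w : T) : R := \sum_(k < n) (v + Ssum X k w).

Definition area_above X (v x : R) p : set T :=
  [set w | 0 <= v + Ssum X p w /\ x < area X v p.+1 w].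

(** Contains the event that the excursion of the walk started at [v] has area larger than
    [x], but depends on the first [n] increments only. *)
Definition large_area X (v x : R) n : set T :=
  (\bigcup_(p < n) area_above X v x p) `|` [set w | 0 < v + Ssum X n w].

Lemma Ssum0 X w : Ssum X 0 w = 0.
Proof. by rewrite /Ssum big_ord0. Qed.

Lemma SsumS X n w : Ssum X n.+1 w = Ssum X n w + X n w.
Proof. by rewrite /Ssum big_ord_recr. Qed.

Lemma Ssum_shift X k j w : Ssum X (k + j) w = Ssum X k w + Ssum (shifted X k) j w.
Proof. by rewrite /Ssum big_split_ord. Qed.

Lemma area0E X n w : area X 0 n w = \sum_(k < n) Ssum X k w.
Proof. by apply: eq_bigr => k _; rewrite add0r. Qed.

Lemma shift_independent X k : mutually_independent X -> mutually_independent (shifted X k).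
Proof.
move=> iX s B us mB.
pose B' i := B (i - k)%N.
have := iX [seq (k + i)%N | i <- s] B'.
rewrite map_inj_uniq; last exact: addnI.
move=> /(_ us (fun i => mB _)); rewrite big_map /B'.
under eq_bigr do rewrite addKn.
move=> <-; congr (P _); apply/seteqP; split=> w /= h i /=.
  by move=> /mapP[j js ->]; rewrite addKn; exact: (h j).
move=> is_; have := h (k + i)%N; rewrite /= addKn; apply.
exact: map_f.
Qed.

Lemma sigma_event_shifted X k I J E : (forall i, I i -> J (k + i)%N) ->
  sigma_event (shifted X k) I E -> sigma_event X J E.
Proof.
move=> IJ; apply: sub_smallest2r; first exact: smallest_sigma_algebra.
by move=> _ [i Ii [B mB ->]]; exists (k + i)%N; [exact: IJ|exists B].
Qed.

Lemma sigma_event_after X k n E :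
  sigma_event (shifted X k.+1) `I_n E -> sigma_event X [set i | (k < i)%N] E.
Proof. by apply: sigma_event_shifted => i _; rewrite /= addSn ltnS leq_addr. Qed.

Lemma adapted_Ssum X n : adapted X `I_n (Ssum X n).
Proof. by apply: (@adapted_sum _ _ _ _ _ _ _ (fun i => X i)) => i; exact: adapted_increment. Qed.

Lemma sub_adapted_Ssum X I n : (forall i, (i < n)%N -> I i) -> adapted X I (Ssum X n).
Proof. by move=> nI; apply: sub_adapted (adapted_Ssum (n := n)) => i; exact: nI. Qed.

Lemma adapted_area X v n : adapted X `I_n (area X v n).
Proof.
apply: (@adapted_sum _ _ _ _ _ _ _ (fun k w => v + Ssum X k w)) => k kn.
apply: measurable_funD; first exact: adapted_cst.
by apply: sub_adapted_Ssum => i /ltn_trans; apply.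
Qed.

Lemma sigma_event_jump X y i : sigma_event X [set i] (jump X y i).
Proof. by apply: sigma_event_ltr; [exact: adapted_cst|exact: adapted_increment]. Qed.

Lemma sigma_event_no_jump X y n : sigma_event X `I_n (no_jump X y n).
Proof.
apply: (sigma_event_bigcap (F := fun i => [set w | X i w <= y])) => i ni.
by apply: sigma_event_ler; [exact: adapted_increment|exact: adapted_cst].
Qed.

Lemma sigma_event_positive_until X n : sigma_event X `I_n (positive_until X n).
Proof.
apply: (sigma_event_bigcap (F := fun k => [set w | 0 < Ssum X k.+1 w])) => k kn.
apply: sigma_event_ltr; first exact: adapted_cst.
by apply: sub_adapted_Ssum => i ik; exact: leq_trans ik kn.
Qed.

Lemma sigma_event_small_fluctuation X a L m : sigma_event X `I_m (small_fluctuation X a L m).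
Proof.
apply: (sigma_event_bigcap (F := fun j => [set w | `|Ssum X j w + j%:R * a| < L])) => j jm.
apply: sigma_event_ltr; last exact: adapted_cst.
apply: measurableT_comp => //; apply: measurable_funD; last exact: adapted_cst.
by apply: sub_adapted_Ssum => i ij; exact: leq_trans ij jm.
Qed.

Lemma sigma_event_area_above X v x p : sigma_event X `I_p.+1 (area_above X v x p).
Proof.
apply: sigma_eventI; last by apply: sigma_event_ltr; [exact: adapted_cst|exact: adapted_area].
apply: sigma_event_ler; first exact: adapted_cst.
apply: measurable_funD; first exact: adapted_cst.
by apply: sub_adapted_Ssum => i /ltnW.
Qed.

Lemma sigma_event_large_area X v x n : sigma_event X `I_n (large_area X v x n).
Proof.
apply: sigma_eventU.
  apply: sigma_event_bigcup => p pn.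
  apply: (@sub_sigma_event _ _ _ _ X `I_p.+1); last exact: sigma_event_area_above.
  by move=> i ip; exact: leq_trans ip pn.
apply: sigma_event_ltr; first exact: adapted_cst.
by apply: measurable_funD; [exact: adapted_cst|exact: adapted_Ssum].
Qed.

Lemma measurable_jump X y i : measurable (jump X y i).
Proof. by apply: sigma_event_measurable; exact: sigma_event_jump. Qed.

Lemma measurable_no_jump X y n : measurable (no_jump X y n).
Proof. by apply: sigma_event_measurable; exact: sigma_event_no_jump. Qed.

Lemma measurable_positive_until X n : measurable (positive_until X n).
Proof. by apply: sigma_event_measurable; exact: sigma_event_positive_until. Qed.

Lemma measurable_area_above X v x p : measurable (area_above X v x p).
Proof. by apply: sigma_event_measurable; exact: sigma_event_area_above. Qed.

Lemma measurable_large_area X v x n : measurable (large_area X v x n).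
Proof. by apply: sigma_event_measurable; exact: sigma_event_large_area. Qed.

Lemma measurable_Ssum_gt X n (h : R) : measurable [set w | h < Ssum X n w].
Proof.
apply: measurable_ltr_set => //.
by apply: adapted_measurable; exact: adapted_Ssum.
Qed.

Lemma pr_past_present_future X k A B E : mutually_independent X ->
  sigma_event X `I_k A -> sigma_event X [set k] B -> sigma_event X [set i | (k < i)%N] E ->
  pr P (A `&` B `&` E) = pr P A * pr P B * pr P E.
Proof.
move=> iX sA sB sE.
have AB : sigma_event X `I_k.+1 (A `&` B).
  apply: sigma_eventI; first by apply: (sub_sigma_event _ sA) => i /= /ltnW.
  by apply: (sub_sigma_event _ sB) => i /= ->.
rewrite (pr_independent iX _ AB sE); last first.
  by apply/seteqP; split=> // i [] /=; lia.
by rewrite (pr_independent iX _ sA sB)//; apply/seteqP; split=> // i [] /=; lia.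
Qed.

End Walk.

Section Excursion.
Context {d : measure_display} {T : measurableType d} {R : realType} {P : probability T R}.
Implicit Types (X : nat -> {RV P >-> R}) (w : T).

Lemma positive_until_le X m n : (m <= n)%N -> positive_until X n `<=` positive_until X m.
Proof. by move=> mn w pn k km; apply: pn; exact: leq_trans mn. Qed.

Lemma positive_until_ge0 X n k w : positive_until X n w -> (k <= n)%N -> 0 <= Ssum X k w.
Proof. by case: k => [|k] pn kn; [rewrite Ssum0|apply/ltW/pn]. Qed.

Lemma positive_untilS X n w : positive_until X n w -> 0 < Ssum X n.+1 w ->
  positive_until X n.+1 w.
Proof. by move=> pn Sn k; rewrite ltnS leq_eqVlt => /orP[/eqP ->//|]; exact: pn. Qed.

Lemma positive_until_before X m n w : positive_until X m w -> Ssum X n.+1 w <= 0 -> (m <= n)%N.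
Proof. by move=> pm Sn; rewrite leqNgt; apply/negP => /pm; rewrite ltNge Sn. Qed.

Variant tau_spec X w : option nat -> Prop :=
| TauFinite n of positive_until X n w & Ssum X n.+1 w <= 0 : tau_spec X w (Some n.+1)
| TauInfinite of (forall n, positive_until X n w) : tau_spec X w None.

Lemma tauP X w : tau_spec X w (tau_opt X w).
Proof.
rewrite /tau_opt; case: pselect => [h|h]; last first.
  constructor=> n k _; rewrite ltNge; apply/negP => Sk; apply: h.
  by exists k.+1.
case: ex_minnP => -[//|n] /andP[_ Sn] n_min; constructor=> // k kn.
by rewrite ltNge; apply/negP => Sk; have := n_min k.+1; rewrite Sk /= => /(_ isT); lia.
Qed.

Lemma Atau_gt_partial_area X (x : R) n w : positive_until X n w -> x < area X 0 n.+1 w ->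
  (x%:E < Atau X w)%E.
Proof.
rewrite area0E /Atau => pn xn; case: tauP => [m pm Sm|_]; last exact: ltry.
rewrite lte_fin (lt_le_trans xn)// -!(big_mkord xpredT (fun k => Ssum X k w)).
have nm := positive_until_before pn Sm.
rewrite [leRHS](@big_cat_nat _ _ _ n.+1)//= lerDl big_nat sumr_ge0// => k /andP[_ km].
exact: positive_until_ge0 pm _.
Qed.

Lemma Atau_gtE X (x : R) : [set w | (x%:E < Atau X w)%E] =
  (\bigcup_n (positive_until X n `&` [set w | x < area X 0 n.+1 w])) `|`
  \bigcap_n positive_until X n.
Proof.
apply/seteqP; split=> w /=.
  rewrite /Atau; case: tauP => [n pn _|pn _]; last by right=> n _.
  by rewrite lte_fin -area0E => xn; left; exists n.
case=> [[n _ [pn xn]]|pn]; first exact: Atau_gt_partial_area xn.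
rewrite /Atau; case: tauP => [n _|_]; last exact: ltry.
by rewrite leNgt (pn n.+1 I n (ltnSn n)).
Qed.

Lemma measurable_Atau_gt X (x : R) : measurable [set w | (x%:E < Atau X w)%E].
Proof.
rewrite Atau_gtE; apply: measurableU; last first.
  by apply: bigcapT_measurable => n; exact: measurable_positive_until.
apply: bigcupT_measurable => n; apply: measurableI; first exact: measurable_positive_until.
by apply: measurable_ltr_set => //; apply: adapted_measurable; exact: adapted_area.
Qed.

Lemma Atau_gt_large_area X (x : R) n : (0 < n)%N ->
  [set w | (x%:E < Atau X w)%E] `<=` large_area X 0 x n.
Proof.
move=> n0 w; rewrite /= /Atau; case: tauP => [m pm _|pos _]; last first.
  by right; rewrite /= add0r; case: n n0 => // n _; exact: (pos n.+1).
rewrite lte_fin -area0E => xm; have [mn|nm] := ltnP m n; last first.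
  by right; rewrite /= add0r; case: n n0 nm => // n _; exact: pm.
by left; exists m => //; split=> //; rewrite add0r; exact: positive_until_ge0 pm _.
Qed.

End Excursion.

Section JumpExcursion.
Context {d : measure_display} {T : measurableType d} {R : realType} {P : probability T R}.
Implicit Types (X : nat -> {RV P >-> R}) (w : T).

Lemma sum_descent (c a : R) n :
  \sum_(j < n) (c - j%:R * a) = n%:R * c - a * (n%:R * (n%:R - 1)) / 2.
Proof.
elim: n => [|n IH]; first by rewrite big_ord0; field.
by rewrite big_ord_recr IH /= -natr1; field.
Qed.

Lemma descent_area_ge (a L x y : R) m : 0 < a -> 0 <= L -> 0 <= y ->
  m%:R * a <= y <= m.+1%:R * a -> 2 * a * x <= y ^+ 2 ->
  x <= \sum_(j < m.+1) (y + L - j%:R * a).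
Proof.
move=> a0 L0 y0; rewrite sum_descent -natr1; have : (0 : R) <= m%:R by [].
move: (m%:R : R) => u u0 /andP[uy yu] xy.
have -> : (u + 1) * (y + L) - a * ((u + 1) * (u + 1 - 1)) / 2 =
  (u + 1) * L + (u + 1) * (y - u * a) / 2 + (u + 1) * y / 2 by field.
have uL : 0 <= (u + 1) * L by rewrite mulr_ge0//; lra.
have uya : 0 <= (u + 1) * (y - u * a) by rewrite mulr_ge0//; lra.
have yuy : y * y <= (u + 1) * a * y by rewrite ler_wpM2r.
suff : a * x <= a * ((u + 1) * y / 2) by rewrite ler_pM2l//; lra.
by move: xy; rewrite expr2; lra.
Qed.

Lemma Ssum_after_jump_gt X (a L y : R) k j w : 0 <= Ssum X k w -> y + 2 * L < X k w ->
  `|Ssum (shifted X k.+1) j w + j%:R * a| < L ->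
  y + L - j%:R * a < Ssum X (k.+1 + j) w.
Proof. rewrite Ssum_shift SsumS ltr_norml => Sk Xk /andP[fluct _]; lra. Qed.

Lemma jump_area X (a L x y : R) k m w : 0 < a -> 0 < L -> 0 <= y ->
  m%:R * a <= y <= m.+1%:R * a -> 2 * a * x <= y ^+ 2 ->
  positive_until X k w -> jump X (y + 2 * L) k w ->
  small_fluctuation (shifted X k.+1) a L m w -> (x%:E < Atau X w)%E.
Proof.
move=> a0 L0 y0 ym xy pk jk fluct; have Sk0 := positive_until_ge0 pk (leqnn k).
have descent j : (j <= m)%N -> y + L - j%:R * a < Ssum X (k.+1 + j) w.
  by move=> jm; apply: Ssum_after_jump_gt => //; exact: fluct.
have pkm : positive_until X (k.+1 + m) w.
  move=> i ikm; have [ik|ki] := ltnP i k; first exact: pk.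
  rewrite -(subnKC ki) -addSn; apply: le_lt_trans (descent _ _); last by lia.
  have : (i - k)%:R * a <= m%:R * a by rewrite ler_wpM2r ?ler_nat ?(ltW a0)//; lia.
  by case/andP: ym; lra.
apply: (Atau_gt_partial_area pkm).
rewrite area0E -addnS big_split_ord /= ltr_wpDl//.
  by apply: sumr_ge0 => i _; apply: (positive_until_ge0 pkm); have := ltn_ord i; lia.
apply: le_lt_trans (descent_area_ge a0 (ltW L0) y0 ym xy) _.
apply: ltr_sum => [|j _]; first by apply/hasP; exists ord0; rewrite ?mem_index_enum.
by apply: descent; rewrite -ltnS.
Qed.

End JumpExcursion.

Section FirstBigJump.
Context {d : measure_display} {T : measurableType d} {R : realType} {P : probability T R}.
Implicit Types (X : nat -> {RV P >-> R}) (w : T).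

Definition high_without_jump X (h b : R) n : set T :=
  \bigcup_(j < n.+1) (no_jump X b j `&` [set w | h < Ssum X j w]).

Definition positive_without_jump X (v b : R) n : set T :=
  no_jump X b n `&` [set w | 0 < v + Ssum X n w].

Lemma measurable_positive_without_jump X v b n : measurable (positive_without_jump X v b n).
Proof.
apply: measurableI; first exact: measurable_no_jump.
rewrite (_ : [set w | _] = [set w | - v < Ssum X n w]); first exact: measurable_Ssum_gt.
by apply/seteqP; split=> w /=; lra.
Qed.

Lemma measurable_high_without_jump X h b n : measurable (high_without_jump X h b n).
Proof.
apply: bigcup_measurable => j _; apply: measurableI; first exact: measurable_no_jump.
exact: measurable_Ssum_gt.
Qed.

Lemma no_jump_or_first_jump X b n w :
  no_jump X b n w \/ exists2 j, (j < n)%N & no_jump X b j w /\ jump X b j w.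
Proof.
elim: n => [|n [nj|[j jn firstj]]]; first by left.
  have [Xn|Xn] := leP (X n w) b; last by right; exists n.
  by left=> i; rewrite ltnS leq_eqVlt => /orP[/eqP ->//|]; exact: nj.
by right; exists j => //; exact: ltnW.
Qed.

Lemma area_le X (h : R) n w : (forall i, (i < n)%N -> Ssum X i w <= h) ->
  area X 0 n w <= n%:R * h.
Proof.
by move=> low; rewrite area0E; apply: (sum_ord_le (F := fun i => Ssum X i w)).
Qed.

(** A walk that stays below [h] for [n] steps has not collected an area larger than
    [n * h]. *)
Lemma positive_until_of_low X (x h : R) n w : 0 <= h -> n%:R * h <= x ->
  (x%:E < Atau X w)%E -> (forall i, (i < n)%N -> Ssum X i w <= h) -> positive_until X n w.
Proof.
move=> h0 nhx; rewrite /Atau; case: tauP => [m pm _|pos _ _]; last exact: pos.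
rewrite lte_fin -area0E => xm low; have [mn|nm] := ltnP m n; last first.
  exact: positive_until_le nm _ pm.
have : area X 0 m.+1 w <= m.+1%:R * h.
  by apply: area_le => i im; apply: low; exact: leq_trans im mn.
have : m.+1%:R * h <= n%:R * h by rewrite ler_wpM2r// ler_nat.
lra.
Qed.

Lemma large_area_after X (v x r : R) j n w : (x%:E < Atau X w)%E ->
  positive_until X j w -> 0 < Ssum X j.+1 w <= v -> area X 0 j.+1 w <= r ->
  large_area (shifted X j.+1) v (x - r) n w.
Proof.
move=> xA pj /andP[Sj0 Sjv] past_area.
have below k : Ssum X (j.+1 + k) w <= v + Ssum (shifted X j.+1) k w.
  by rewrite Ssum_shift lerD2r.
have pos k : positive_until X (j.+1 + k) w -> 0 < v + Ssum (shifted X j.+1) k w.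
  by move=> pjk; apply: lt_le_trans (below k); rewrite addSn; apply: pjk; rewrite addSn.
move: xA; rewrite /Atau; case: tauP => [m pm Sm|p _]; last by right; exact: pos.
have jm := positive_until_before (positive_untilS pj Sj0) Sm.
rewrite lte_fin -area0E => xm; have [mn|nm] := ltnP (m - j.+1)%N n; last first.
  by right; apply: pos; apply: positive_until_le pm; rewrite -(subnKC jm) leq_add2l.
left; exists (m - j.+1)%N => //; split; first by apply/ltW/pos; rewrite subnKC.
move: xm; rewrite -{1}(subnKC jm) -addnS area0E big_split_ord /= -area0E => xm.
rewrite ltrBlDl; apply: lt_le_trans xm _; apply: lerD past_area _.
by apply: ler_sum => k _; exact: below.
Qed.

Lemma first_big_jump X (x y h b : R) n0 n1 L w : 0 < h -> 0 < b -> (0 < n0)%N ->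
  n0%:R * h <= x -> y <= L%:R * h -> (x%:E < Atau X w)%E ->
  [\/ high_without_jump X h b n0 w, positive_without_jump X 0 b n0 w |
    exists2 j, (j < n0)%N & positive_until X j w /\ (jump X y j w \/
      exists2 l, (l < L)%N & jump X (Num.max (l%:R * h) b) j w /\
        large_area (shifted X j.+1) (l.+2%:R * h) (x - n0%:R * h) n1 w)].
Proof.
move=> h0 b0 n00 n0h yL xA.
have [|nhigh] := pselect (high_without_jump X h b n0 w); first by constructor 1.
have low j : (j <= n0)%N -> no_jump X b j w -> forall i, (i <= j)%N -> Ssum X i w <= h.
  move=> jn nj i ij; rewrite leNgt; apply/negP => hS; apply: nhigh.
  by exists i; [rewrite /= ltnS (leq_trans ij)|split=> // k ki; apply: nj; exact: leq_trans ij].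
have pos j : (j <= n0)%N -> no_jump X b j w -> positive_until X j w.
  move=> jn nj; apply: (positive_until_of_low (ltW h0) _ xA) => [|i ij].
    by apply: le_trans n0h; rewrite ler_wpM2r ?ler_nat ?ltW.
  exact: low jn nj _ (ltnW ij).
have [nj|[j jn [nj bX]]] := no_jump_or_first_jump X b n0 w.
  constructor 2; split=> //; rewrite /= add0r.
  by case: n0 n00 n0h nhigh low pos nj => // n _ _ _ _ pos nj; exact: pos (leqnn _) nj _ _.
have pj := pos j (ltnW jn) nj; constructor 3; exists j => //; split=> //.
have [Xy|yX] := leP (X j w) y; last by left.
right; have [|l lL /andP[lX Xl]] := @grid_cell _ h (X j w) L.
  by rewrite (lt_trans b0 bX) (le_trans Xy yL).
exists l => //; split; first by rewrite /jump /= gt_max lX.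
apply: (large_area_after _ xA pj); last first.
  apply: le_trans (area_le (h := h) _) _ => [i ij|]; first exact: low (ltnW jn) nj _ _.
  by rewrite ler_wpM2r ?ler_nat ?(ltW h0).
have Sj0 := positive_until_ge0 pj (leqnn j); have Sjh := low j (ltnW jn) nj j (leqnn j).
by rewrite SsumS ltr_wpDl ?(lt_trans b0)//= -natr1 mulrDl mul1r addrC lerD.
Qed.

End FirstBigJump.

(** * The area under an excursion without large jumps *)

Section ExponentialBound.
Context {d : measure_display} {T : measurableType d} {R : realType} {P : probability T R}.
Implicit Types (X : nat -> {RV P >-> R}) (a C lam y v x : R).

Definition trunc_exp (u y s : R) : R := if s <= y then expR (u * s) else 0.

Definition truncated_mgf_bound X a C lam y : Prop := forall i u, 0 <= u <= lam ->
  (\int[P]_w (trunc_exp u y (X i w))%:E <= (expR (- (a * u) + C * u ^+ 2))%:E)%E.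

Lemma trunc_exp_ge0 u y s : 0 <= trunc_exp u y s.
Proof. by rewrite /trunc_exp; case: ifP => // _; exact: expR_ge0. Qed.

Lemma measurable_trunc_exp u y : measurable_fun setT (trunc_exp u y).
Proof.
apply: measurable_fun_ifT => //.
- exact: measurable_fun_ler.
- by apply: measurableT_comp => //; exact: mulrl_measurable.
Qed.

Lemma truncated_mgf_bound_shifted X k a C lam y :
  truncated_mgf_bound X a C lam y -> truncated_mgf_bound (shifted X k) a C lam y.
Proof. by move=> mgf i; exact: mgf. Qed.

Lemma integral_tilted_le1 X a C lam y i u : truncated_mgf_bound X a C lam y ->
  0 <= u <= lam ->
  (\int[P]_w (expR (a * u - C * u ^+ 2) * trunc_exp u y (X i w))%:E <= 1)%E.
Proof.
move=> mgf ulam; under eq_integral do rewrite EFinM.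
rewrite ge0_integralZl ?lee_fin ?expR_ge0//; last 2 first.
- apply/measurable_EFinP; apply: measurableT_comp => //; exact: measurable_trunc_exp.
- by move=> w _; rewrite lee_fin trunc_exp_ge0.
apply: (@le_trans _ _ ((expR (a * u - C * u ^+ 2))%:E *
    (expR (- (a * u) + C * u ^+ 2))%:E)%E).
  by rewrite lee_wpmul2l ?lee_fin ?expR_ge0//; exact: mgf.
by rewrite -EFinM -expRD lee_fin -[leRHS]expR0 ler_expR; lra.
Qed.

(** The constraint [n <= m] on the stopping index is what makes the compensator
    [sum_(i < n) (a l_i - C l_i ^ 2)] available in the bound. *)
Lemma pr_max_weighted_sum X a C lam y (l : nat -> R) n N (L : R) (E : set T) :
  mutually_independent X -> truncated_mgf_bound X a C lam y ->
  0 <= C -> C * lam <= a -> (forall i, (i < N)%N -> 0 <= l i <= lam) -> (n <= N)%N ->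
  measurable E ->
  (forall w, E w -> exists2 m, (n <= m <= N)%N &
     no_jump X y m w /\ L <= \sum_(i < m) l i * X i w) ->
  pr P E <= expR (- (L + \sum_(i < n) (a * l i - C * l i ^+ 2))).
Proof.
move=> iX mgf C0 Clam lN nN mE sub.
pose c i := a * l i - C * l i ^+ 2.
pose phi i s := expR (c i) * trunc_exp (l i) y s.
rewrite expRN; apply: (@pr_max_prod _ _ _ _ X phi _ N) => //.
- by move=> i; apply: measurable_funM => //; exact: measurable_trunc_exp.
- by move=> i s; rewrite mulr_ge0 ?expR_ge0 ?trunc_exp_ge0.
- by move=> i iN; apply: integral_tilted_le1 mgf _; exact: lN.
- exact: expR_gt0.
move=> w /sub[m /andP[nm mN] [Xy LX]]; exists m => //.
have -> : \prod_(i < m) phi i (X i w) = expR (\sum_(i < m) l i * X i w + \sum_(i < m) c i).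
  rewrite -big_split /= expR_sum; apply: eq_bigr => i _.
  by rewrite /phi /trunc_exp Xy// -expRD addrC.
rewrite ler_expR lerD// -!(big_mkord xpredT c) (big_cat_nat (leq0n n) nm) /= lerDl.
rewrite big_nat sumr_ge0// => i /andP[_ im].
have /andP[l0 llam] := lN i (leq_trans im mN).
rewrite /c subr_ge0 expr2 mulrA ler_wpM2r//.
by apply: le_trans Clam; rewrite ler_wpM2l.
Qed.

Lemma pr_high_without_jump X a C lam b h n :
  mutually_independent X -> truncated_mgf_bound X a C lam b ->
  0 <= C -> 0 <= lam -> C * lam <= a ->
  pr P (high_without_jump X h b n) <= expR (- (lam * h)).
Proof.
move=> iX mgf C0 lam0 Clam.
have := @pr_max_weighted_sum X a C lam b (fun=> lam) 0 n (lam * h) (high_without_jump X h b n)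
  iX mgf C0 Clam.
rewrite big_ord0 addr0; apply => //.
- by move=> i _; rewrite lam0 lexx.
- exact: measurable_high_without_jump.
- move=> w [j jn [nj hS]]; exists j; first exact: jn.
  by split=> //; rewrite -mulr_sumr ler_wpM2l// ltW.
Qed.

Lemma pr_positive_without_jump X a C lam b v n :
  mutually_independent X -> truncated_mgf_bound X a C lam b ->
  0 <= C -> 0 <= lam -> C * lam <= a ->
  pr P (positive_without_jump X v b n) <= expR (lam * (v - (a - C * lam) * n%:R)).
Proof.
move=> iX mgf C0 lam0 Clam.
have lamn i : (i < n)%N -> 0 <= lam <= lam by rewrite lam0 lexx.
apply: le_trans (pr_max_weighted_sum (L := - (lam * v)) iX mgf C0 Clam lamn (leqnn n) _ _) _.
- exact: measurable_positive_without_jump.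
- move=> w [nj /= Sn]; exists n; first by rewrite leqnn.
  by split=> //; rewrite -mulr_sumr -mulrN ler_wpM2l// -/(Ssum X n w); lra.
- by rewrite sumr_const card_ord ler_expR -[X in _ + X]mulr_natl; apply: eq_implies_le; ring.
Qed.

Lemma area_by_increments X (N v : R) p w : area X v p.+1 w =
  N * v + \sum_(i < p) (N - 1 - i%:R) * X i w - (N - 1 - p%:R) * (v + Ssum X p w).
Proof.
rewrite /area; elim: p => [|p IH]; first by rewrite big_ord_recl !big_ord0 /= Ssum0; ring.
by rewrite big_ord_recr IH [in RHS]big_ord_recr /= SsumS -natr1; ring.
Qed.

Lemma sum_linear_weights (N : R) m :
  \sum_(i < m) (N - 1 - i%:R) = m%:R * (2 * N - 1 - m%:R) / 2.
Proof.
elim: m => [|m IH]; first by rewrite big_ord0 !mul0r.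
by rewrite big_ord_recr IH /= -natr1; field.
Qed.

Lemma linear_weight_itv lam n N i : 0 <= lam -> (n%:R <= N) -> (i < n)%N ->
  0 <= lam / N * (N - 1 - i%:R) <= lam.
Proof.
move=> lam0 nN i_n; have : (i.+1%:R : R) <= n%:R by rewrite ler_nat.
rewrite -natr1 => iN; have i0 : (0 : R) <= i%:R by [].
have N0 : 0 < N by lra.
rewrite mulr_ge0 ?divr_ge0 ?(ltW N0)//=; last by lra.
rewrite -[leRHS]mulr1 -mulrA ler_wpM2l// mulrC ler_pdivrMr//; lra.
Qed.

Lemma linear_tilt_exponent_ge a C lam v x (N : R) n W : 0 <= a -> 0 <= C -> 0 <= lam ->
  (0 < W)%N -> N = (n + W)%:R ->
  lam * (x / N - v + a * (N / 2 - 1 / 2 - W%:R ^+ 2 / (2 * N)) - C * lam * N) <=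
  lam / N * (x - N * v) + \sum_(i < n) (a * (lam / N * (N - 1 - i%:R)) -
                                        C * (lam / N * (N - 1 - i%:R)) ^+ 2).
Proof.
move=> a0 C0 lam0 W0 NE; have N0 : 0 < N by rewrite NE ltr0n addn_gt0 W0 orbT.
have W0' : (0 : R) <= W%:R by [].
have nN : n%:R <= N by rewrite NE ler_nat leq_addr.
have sqr_weights : \sum_(i < n) (lam / N * (N - 1 - i%:R)) ^+ 2 <= N * lam ^+ 2.
  apply: le_trans (_ : _ <= n%:R * lam ^+ 2) _; last by rewrite ler_wpM2r ?sqr_ge0.
  apply: (sum_ord_le (F := fun i => (lam / N * (N - 1 - i%:R)) ^+ 2)) => i i_n.
  by have /andP[l0 l1] := linear_weight_itv lam0 nN i_n; rewrite ler_pXn2r.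
rewrite sumrB -!mulr_sumr sum_linear_weights.
have -> : n%:R = N - W%:R :> R by rewrite NE natrD; ring.
have := ler_wpM2l C0 sqr_weights.
have : 0 <= a * lam * W%:R / (2 * N) by rewrite !mulr_ge0 ?invr_ge0 ?mulr_ge0 ?(ltW N0).
have : lam * (x / N - v + a * (N / 2 - 1 / 2 - W%:R ^+ 2 / (2 * N)) - C * lam * N)
     + a * lam * W%:R / (2 * N)
   = lam / N * (x - N * v) + a * (lam / N * ((N - W%:R) * (2 * N - 1 - (N - W%:R)) / 2))
     - C * (N * lam ^+ 2).
  by field; rewrite gt_eqF.
lra.
Qed.

(** The inequality of arithmetic and geometric means between the terms in [1 / N] and [N]. *)
Lemma exponent_amgm a C lam v x N W : 0 < N -> 0 <= lam ->
  0 <= x - a * W ^+ 2 / 2 -> 0 <= a / 2 - C * lam ->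
  lam * (2 * Num.sqrt ((x - a * W ^+ 2 / 2) * (a / 2 - C * lam)) - v - a / 2) <=
  lam * (x / N - v + a * (N / 2 - 1 / 2 - W ^+ 2 / (2 * N)) - C * lam * N).
Proof.
move=> N0 lam0 x0 c0; rewrite ler_wpM2l// sqrtrM//.
set p := Num.sqrt (x - _); set q := Num.sqrt (a / 2 - _).
have p2 : p ^+ 2 = x - a * W ^+ 2 / 2 by rewrite sqr_sqrtr.
have q2 : q ^+ 2 = a / 2 - C * lam by rewrite sqr_sqrtr.
have -> : x / N - v + a * (N / 2 - 1 / 2 - W ^+ 2 / (2 * N)) - C * lam * N =
   p ^+ 2 / N + q ^+ 2 * N - v - a / 2.
  by rewrite p2 q2; field; rewrite gt_eqF.
have : 0 <= (p - q * N) ^+ 2 / N by rewrite divr_ge0 ?sqr_ge0 ?(ltW N0).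
have -> : (p - q * N) ^+ 2 / N = p ^+ 2 / N + q ^+ 2 * N - 2 * (p * q).
  by field; rewrite gt_eqF.
lra.
Qed.

Definition area_window X y v x n W : set T :=
  no_jump X y (n + W) `&` \bigcup_(i < W) area_above X v x (n + i).

Lemma measurable_area_window X y v x n W : measurable (area_window X y v x n W).
Proof.
apply: measurableI; first exact: measurable_no_jump.
by apply: bigcup_measurable => i _; exact: measurable_area_above.
Qed.

Lemma pr_area_window X a C lam y v x n W :
  mutually_independent X -> truncated_mgf_bound X a C lam y ->
  0 < a -> 0 <= C -> 0 <= lam -> 0 <= a / 2 - C * lam -> (0 < W)%N ->
  0 <= x - a * W%:R ^+ 2 / 2 ->
  pr P (area_window X y v x n W) <=
  expR (- (lam * (2 * Num.sqrt ((x - a * W%:R ^+ 2 / 2) * (a / 2 - C * lam)) - v - a / 2))).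
Proof.
move=> iX mgf a0 C0 lam0 c0 W0 x0; pose N : R := (n + W)%:R.
have N0 : 0 < N by rewrite ltr0n addn_gt0 W0 orbT.
have Clam : C * lam <= a by lra.
have lN i := @linear_weight_itv lam (n + W) N i lam0 (lexx _).
apply: le_trans (pr_max_weighted_sum (L := lam / N * (x - N * v)) iX mgf C0 Clam lN
  (leq_addr _ _) (measurable_area_window X y v x n W) _) _.
  move=> w [nj [i iW [Sp xp]]]; set p := (n + i)%N in Sp xp.
  have pN : (p < n + W)%N by rewrite ltn_add2l.
  exists p; first by rewrite leq_addr ltnW.
  split; first by move=> k kp; apply: nj; exact: ltn_trans pN.
  have -> : \sum_(k < p) lam / N * (N - 1 - k%:R) * X k w =
      lam / N * \sum_(k < p) (N - 1 - k%:R) * X k w.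
    by rewrite mulr_sumr; apply: eq_bigr => k _; rewrite mulrA.
  apply: ler_wpM2l; first by rewrite divr_ge0 ?(ltW N0).
  move: xp; rewrite (area_by_increments X N) => /ltW.
  have : (p.+1%:R : R) <= N by rewrite ler_nat.
  rewrite -natr1 => pN'.
  have : 0 <= (N - 1 - p%:R) * (v + Ssum X p w) by rewrite mulr_ge0//; lra.
  by lra.
rewrite ler_expR lerN2.
apply: le_trans (linear_tilt_exponent_ge v x (ltW a0) C0 lam0 W0 erefl).
exact: exponent_amgm.
Qed.

Lemma large_area_cover X y v x m W : (0 < W)%N -> large_area X v x (m * W) `<=`
  \bigcup_(i < m * W) jump X y i `|`
  (\bigcup_(b < m) area_window X y v x (b * W) W `|` positive_without_jump X v y (m * W)).
Proof.
move=> W0 w large; have [nj|[i im [_ ji]]] := no_jump_or_first_jump X y (m * W) w; last first.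
  by left; exists i.
right; case: large => [[p pm xp]|Sn]; last by right.
have bm : (p %/ W < m)%N by rewrite ltn_divLR.
left; exists (p %/ W)%N => //; split.
  by move=> i ib; apply: nj; apply: leq_trans ib _; rewrite -mulSnr leq_mul2r bm orbT.
by exists (p %% W)%N; rewrite -?divn_eq//= ltn_mod.
Qed.

Lemma pr_large_area X a C lam y v x (F : R) m W :
  mutually_independent X -> truncated_mgf_bound X a C lam y ->
  (forall i, pr P (jump X y i) <= F) ->
  0 < a -> 0 <= C -> 0 <= lam -> 0 <= a / 2 - C * lam -> (0 < W)%N ->
  0 <= x - a * W%:R ^+ 2 / 2 ->
  pr P (large_area X v x (m * W)) <= (m * W)%:R * F + (m%:R *
    expR (- (lam * (2 * Num.sqrt ((x - a * W%:R ^+ 2 / 2) * (a / 2 - C * lam)) - v - a / 2)))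
    + expR (lam * (v - (a - C * lam) * (m * W)%:R))).
Proof.
move=> iX mgf jumpF a0 C0 lam0 c0 W0 x0; set n := (m * W)%N.
have mJ : measurable (\bigcup_(i < n) jump X y i).
  by apply: bigcup_measurable => i _; exact: measurable_jump.
have mW : measurable (\bigcup_(b < m) area_window X y v x (b * W) W).
  by apply: bigcup_measurable => b _; exact: measurable_area_window.
have mlast := measurable_positive_without_jump X v y n.
apply: le_trans (pr_leU P _ mJ (measurableU _ _ mW mlast) (@large_area_cover X y v x m W W0)) _.
  exact: measurable_large_area.
apply: lerD.
  apply: (pr_le_natmul mJ _ (@subset_refl _ _)) => i; last by move=> _.
  exact: measurable_jump.
apply: le_trans (pr_leU P (measurableU _ _ mW mlast) mW mlast (@subset_refl _ _)) _.
apply: lerD.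
  apply: (pr_le_natmul mW _ (@subset_refl _ _)) => b; first exact: measurable_area_window.
  by move=> _; exact: pr_area_window mgf a0 C0 lam0 c0 W0 x0.
by apply: pr_positive_without_jump iX mgf C0 lam0 _; lra.
Qed.

End ExponentialBound.

(** * Decompositions along the time of the big jump *)

Section ExpectedDuration.
Context {d : measure_display} {T : measurableType d} {R : realType} {P : probability T R}.
Implicit Types (X : nat -> {RV P >-> R}).

Lemma sum_indic_positive_until X K w : \sum_(k < K) \1_(positive_until X k) w =
  (if tau_opt X w is Some m then minn K m else K)%:R :> R.
Proof.
case: tauP => [n pn Sn|pos]; elim: K => [|K IH]; rewrite ?big_ord0//
  big_ord_recr /= IH indicE; last by rewrite mem_set ?natr1//; exact: pos.
have [Kn|nK] := leqP K n.
  by rewrite mem_set ?natr1; [congr _%:R; lia|exact: positive_until_le Kn _ pn].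
rewrite memNset ?addr0; first by congr _%:R; lia.
by move=> /positive_until_before/(_ Sn); lia.
Qed.

Lemma tau_series X w :
  tau X w = (\sum_(0 <= k <oo) (\1_(positive_until X k) w : R)%:E)%E.
Proof.
have partial : (fun K => \sum_(0 <= k < K) (\1_(positive_until X k) w : R)%:E)%E =
    (fun K => ((if tau_opt X w is Some m then minn K m else K)%:R : R)%:E).
  by apply/funext => K; rewrite big_mkord sumEFin sum_indic_positive_until.
rewrite partial /tau; case: (tau_opt X w) => [m|]; apply/esym.
  apply: lim_near_cst => //; near=> K; congr (_%:R)%:E; apply/minn_idPr.
  by near: K; exact: nbhs_infty_ge.
by apply/cvg_lim => //; exact/cvgenyP.
Unshelve. all: by end_near. Qed.

Lemma Etau_series X : Etau X = (\sum_(0 <= k <oo) P (positive_until X k))%E.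
Proof.
rewrite /Etau; under eq_integral do rewrite tau_series.
rewrite integral_nneseries//; last first.
  by move=> k; apply/measurable_EFinP/measurable_indic; exact: measurable_positive_until.
apply: eq_eseriesr => k _; rewrite integral_indic ?setIT//.
exact: measurable_positive_until.
Qed.

Lemma Etau_gt X c : (c%:E < Etau X)%E ->
  exists K, c < \sum_(k < K) pr P (positive_until X k).
Proof.
rewrite Etau_series => cE; apply: contrapT => no_partial; move: cE.
apply/negP; rewrite -leNgt; apply: lime_le; first exact: is_cvg_nneseries.
near=> K; rewrite big_mkord.
under eq_bigr do rewrite (prE _ (measurable_positive_until _ _)).
by rewrite sumEFin lee_fin leNgt; apply/negP => cK; apply: no_partial; exists K.
Unshelve. all: by end_near. Qed.

End ExpectedDuration.

Section BigJumpProbability.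
Context {d : measure_display} {T : measurableType d} {R : realType} {P : probability T R}.
Implicit Types (X : nat -> {RV P >-> R}).

Lemma pr_jump X y i : identically_distributed X -> pr P (jump X y i) = Fbar X y.
Proof.
move=> idX; rewrite /pr /Fbar; congr fine.
have jumpE j : jump X y j = X j @^-1` `]y, +oo[.
  by apply/seteqP; split=> w /=; rewrite in_itv /= andbT.
by rewrite -/(jump X y 0) !jumpE; exact: (idX i _ (measurable_itv `]y, +oo[)).
Qed.

Lemma Fbar_ge0 X y : 0 <= Fbar X y. Proof. by rewrite fine_ge0. Qed.

Definition first_jump_excursion X (a L z : R) m k : set T :=
  (positive_until X k `&` no_jump X z k) `&` jump X z k `&`
  small_fluctuation (shifted X k.+1) a L m.

Lemma measurable_positive_no_jump X z k : measurable (positive_until X k `&` no_jump X z k).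
Proof. by apply: measurableI; [exact: measurable_positive_until|exact: measurable_no_jump]. Qed.

Lemma measurable_small_fluctuation X a L m : measurable (small_fluctuation X a L m).
Proof. by apply: sigma_event_measurable; exact: sigma_event_small_fluctuation. Qed.

Lemma measurable_first_jump_excursion X a L z m k : measurable (first_jump_excursion X a L z m k).
Proof.
apply: measurableI; last exact: measurable_small_fluctuation.
by apply: measurableI; [exact: measurable_positive_no_jump|exact: measurable_jump].
Qed.

Lemma trivIset_first_jump_excursion X a L z m : trivIset setT (first_jump_excursion X a L z m).
Proof.
apply: ltn_trivIset => j i ij; apply/seteqP; split=> // w [[[_ ji] _] [[[_ nj] _] _]].
by have := nj i ij; rewrite leNgt ji.
Qed.

Lemma pr_positive_no_jump_ge X z k : identically_distributed X ->
  pr P (positive_until X k) - k%:R * Fbar X z <= pr P (positive_until X k `&` no_jump X z k).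
Proof.
move=> idX; rewrite lerBlDr.
have mJ : measurable (\bigcup_(i < k) jump X z i).
  by apply: bigcup_measurable => i _; exact: measurable_jump.
have mA := measurable_positive_no_jump X z k.
apply: le_trans (pr_leU P (measurable_positive_until X k) mA mJ _) _.
  move=> w pk; have [nj|[i ik [_ ji]]] := no_jump_or_first_jump X z k w; first by left.
  by right; exists i.
rewrite lerD2l; apply: (pr_le_natmul mJ _ (@subset_refl _ _)) => i; first exact: measurable_jump.
by move=> _; rewrite pr_jump.
Qed.

Lemma pr_first_jump_excursion X a L z m k : iid X ->
  pr P (first_jump_excursion X a L z m k) =
  Fbar X z * (pr P (small_fluctuation (shifted X k.+1) a L m) *
    pr P (positive_until X k `&` no_jump X z k)).
Proof.
move=> [iX idX]; rewrite (pr_past_present_future (k := k) iX) ?pr_jump//; first by ring.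
- by apply: sigma_eventI; [exact: sigma_event_positive_until|exact: sigma_event_no_jump].
- exact: sigma_event_jump.
- by apply: sigma_event_after; exact: sigma_event_small_fluctuation.
Qed.

Lemma PAtau_gt_ge X (a L x y z q : R) K m : iid X -> 0 < a -> 0 < L -> 0 <= y ->
  m%:R * a <= y <= m.+1%:R * a -> 2 * a * x <= y ^+ 2 -> 0 <= q ->
  (forall k, q <= pr P (small_fluctuation (shifted X k.+1) a L m)) ->
  z = y + 2 * L ->
  Fbar X z * (q * (\sum_(k < K) pr P (positive_until X k) - K%:R ^+ 2 * Fbar X z)) <=
  PAtau_gt X x.
Proof.
move=> iidX a0 L0 y0 ym xy q0 fluct zE.
apply: (@le_trans _ _ (\sum_(k < K) pr P (first_jump_excursion X a L z m k))); last first.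
  apply: pr_sum_le; [exact: measurable_Atau_gt|exact: measurable_first_jump_excursion| |].
    by apply: sub_trivIset (trivIset_first_jump_excursion (m := m)).
  by move=> w [k _ [[[pk _] jk] sk]]; rewrite zE in jk; exact: jump_area a0 L0 y0 ym xy pk jk sk.
have -> : Fbar X z * (q * (\sum_(k < K) pr P (positive_until X k) - K%:R ^+ 2 * Fbar X z)) =
    \sum_(k < K) Fbar X z * (q * (pr P (positive_until X k) - K%:R * Fbar X z)).
  by rewrite -!mulr_sumr sumrB sumr_const card_ord -(mulr_natl (K%:R * Fbar X z)); ring.
apply: ler_sum => k _; rewrite pr_first_jump_excursion// ler_wpM2l ?Fbar_ge0//.
apply: le_trans (_ : q * pr P (positive_until X k `&` no_jump X z k) <= _); last first.
  by rewrite ler_wpM2r ?pr_ge0.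
rewrite ler_wpM2l//; apply: le_trans (pr_positive_no_jump_ge z k iidX.2).
by rewrite lerD2l lerN2 ler_wpM2r ?Fbar_ge0// ler_nat ltnW.
Qed.

Lemma pr_positive_jump_future X j (z q : R) E : iid X ->
  sigma_event X [set i | (j < i)%N] E -> pr P E <= q ->
  pr P (positive_until X j `&` jump X z j `&` E) <= pr P (positive_until X j) * (Fbar X z * q).
Proof.
move=> [iX idX] sE Eq; rewrite (pr_past_present_future (k := j) iX) ?pr_jump//.
- by rewrite -mulrA ler_wpM2l ?pr_ge0// ler_wpM2l ?Fbar_ge0.
- exact: sigma_event_positive_until.
- exact: sigma_event_jump.
Qed.

Definition big_jump_at X (x y h b : R) n0 n1 L j : set T :=
  (positive_until X j `&` jump X y j) `|`
  \bigcup_(l < L) (positive_until X j `&` jump X (Num.max (l%:R * h) b) j `&`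
    large_area (shifted X j.+1) (l.+2%:R * h) (x - n0%:R * h) n1).

Lemma measurable_big_jump_at X x y h b n0 n1 L j : measurable (big_jump_at X x y h b n0 n1 L j).
Proof.
have mpj z : measurable (positive_until X j `&` jump X z j).
  by apply: measurableI; [exact: measurable_positive_until|exact: measurable_jump].
apply: measurableU => //; apply: bigcup_measurable => l _; apply: measurableI => //.
exact: measurable_large_area.
Qed.

Lemma pr_big_jump_at X x y h b n0 n1 L (Q : nat -> R) j : iid X ->
  (forall l, (l < L)%N ->
    pr P (large_area (shifted X j.+1) (l.+2%:R * h) (x - n0%:R * h) n1) <= Q l) ->
  pr P (big_jump_at X x y h b n0 n1 L j) <= pr P (positive_until X j) *
    (Fbar X y + \sum_(l < L) Fbar X (Num.max (l%:R * h) b) * Q l).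
Proof.
move=> iidX hQ; pose B l := positive_until X j `&` jump X (Num.max (l%:R * h) b) j `&`
  large_area (shifted X j.+1) (l.+2%:R * h) (x - n0%:R * h) n1.
have mpj z : measurable (positive_until X j `&` jump X z j).
  by apply: measurableI; [exact: measurable_positive_until|exact: measurable_jump].
have mB l : measurable (B l) by apply: measurableI => //; exact: measurable_large_area.
have mBU : measurable (\bigcup_(l < L) B l) by exact: bigcup_measurable.
apply: le_trans (pr_leU P _ (mpj y) mBU (@subset_refl _ _)) _.
  exact: measurableU.
rewrite mulrDr mulr_sumr; apply: lerD.
  have := pr_positive_jump_future y iidX (@sigma_eventT _ _ _ _ X [set i | (j < i)%N]) (lexx _).
  by rewrite setIT pr_setT mulr1.
apply: le_trans (pr_le_sum P mBU mB (@subset_refl _ _)) _; apply: ler_sum => l _.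
apply: pr_positive_jump_future; [exact: iidX| |exact: hQ].
by apply: sigma_event_after; exact: sigma_event_large_area.
Qed.

Lemma PAtau_gt_le X (x y h b e : R) n0 n1 L (Q : nat -> R) : iid X ->
  0 < h -> 0 < b -> (0 < n0)%N -> n0%:R * h <= x -> y <= L%:R * h ->
  pr P (high_without_jump X h b n0) <= e ->
  pr P (positive_without_jump X 0 b n0) <= e ->
  (forall j l, (l < L)%N ->
    pr P (large_area (shifted X j.+1) (l.+2%:R * h) (x - n0%:R * h) n1) <= Q l) ->
  PAtau_gt X x <= 2 * e + (\sum_(j < n0) pr P (positive_until X j)) *
    (Fbar X y + \sum_(l < L) Fbar X (Num.max (l%:R * h) b) * Q l).
Proof.
move=> iidX h0 b0 n00 n0h yL high_e pos_e hQ.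
pose G := big_jump_at X x y h b n0 n1 L.
have mG j : measurable (G j) by exact: measurable_big_jump_at.
have mGU : measurable (\bigcup_(j < n0) G j) by exact: bigcup_measurable.
have mH := measurable_high_without_jump X h b n0.
have mN := measurable_positive_without_jump X 0 b n0.
have mHN := measurableU _ _ mH mN.
apply: le_trans (pr_leU P (measurable_Atau_gt X x) mHN mGU _) _.
  move=> w /(first_big_jump n1 h0 b0 n00 n0h yL)[Hw|Nw|[j jn [pj c]]].
  - by left; left.
  - by left; right.
  - right; exists j => //; case: c => [yX|[l lL [mX lw]]]; first by left; split.
    by right; exists l.
apply: lerD.
  by apply: le_trans (pr_leU P mHN mH mN (@subset_refl _ _)) _; lra.
apply: le_trans (pr_le_sum P mGU mG (@subset_refl _ _)) _.
rewrite mulr_suml; apply: ler_sum => j _.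
exact: pr_big_jump_at iidX (hQ j).
Qed.

End BigJumpProbability.

(** * Exponential moments of truncated increments *)

Lemma expR_le_quadratic (R : realType) (u : R) : u <= 1 -> expR u <= 1 + u + 2 * u ^+ 2.
Proof.
move=> u1.
have q0 : 0 < 1 - u / 2 by lra.
have exp_half_ge : 1 - u / 2 <= expR (- (u / 2)) by have := expR_ge1Dx (- (u / 2)); lra.
have split_exp : expR u * expR (- (u / 2)) ^+ 2 = 1.
  by rewrite -expRM_natl -expRD (_ : u + _ = 0) ?expR0//; lra.
have exp_sqr_le1 : expR u * (1 - u / 2) ^+ 2 <= 1.
  rewrite -[leRHS]split_exp ler_wpM2l ?expR_ge0//.
  by rewrite ler_pXn2r ?nnegrE ?(ltW q0) ?expR_ge0.
have sqr_gt0 : 0 < (1 - u / 2) ^+ 2 by rewrite exprn_gt0.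
rewrite -(ler_pM2r sqr_gt0); apply: le_trans exp_sqr_le1 _.
have -> : (1 + u + 2 * u ^+ 2) * (1 - u / 2) ^+ 2 =
  1 + u ^+ 2 * ((1 - u) * (5 / 4 - u / 2)) by field.
by rewrite lerDl mulr_ge0 ?sqr_ge0 ?mulr_ge0//; lra.
Qed.

Lemma quadratic_ge0 (R : realFieldType) (u : R) : 0 <= 1 + u + 2 * u ^+ 2.
Proof. by have := sqr_ge0 (u + 1 / 4); lra. Qed.

Lemma sum_inv_sqr_le2 (R : realType) K : \sum_(k < K) (k.+1%:R ^- 2 : R) <= 2.
Proof.
case: K => [|K]; first by rewrite big_ord0.
suff : \sum_(k < K.+1) (k.+1%:R ^- 2 : R) <= 2 - K.+1%:R^-1.
  by move/le_trans; apply; rewrite lerBlDr lerDl invr_ge0.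
elim: K => [|K IH]; first by rewrite big_ord_recl big_ord0 /= invr1 expr1n invr1; lra.
rewrite big_ord_recr /=; apply: le_trans (lerD IH (lexx _)) _.
have K1_gt0 : (0 : R) < K.+1%:R by [].
have K2_gt0 : (0 : R) < K.+2%:R by [].
have K2E : (K.+2%:R : R) = K.+1%:R + 1 by rewrite -natr1.
rewrite -subr_ge0.
have -> : 2 - K.+2%:R^-1 - (2 - K.+1%:R^-1 + K.+2%:R ^- 2) =
    (K.+1%:R * K.+2%:R ^+ 2)^-1 :> R.
  by move: K1_gt0 K2_gt0; rewrite K2E; move: (K.+1%:R : R) => z z0 z1; field; rewrite !gt_eqF.
by rewrite invr_ge0 mulr_ge0// exprn_ge0.
Qed.

(** [e ^ r <= 1 + r + 2 r ^ 2] for [r <= 1], and the part [1 < r] is cut into the layers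
    [k + 1 < r <= k + 2], where [r = l * s]. *)
Lemma trunc_exp_le_layers (R : realType) (l w s : R) : 0 < l ->
  trunc_exp l w s <= 1 + l * s + 2 * l ^+ 2 * s ^+ 2 +
    \sum_(k < Num.truncn (l * w)) expR k.+2%:R * (k.+1%:R / l < s)%R%:R.
Proof.
move=> l0; set q := 1 + _ + _; set layers := \sum_(k < _) _.
have layers0 : 0 <= layers by apply: sumr_ge0 => k _; rewrite mulr_ge0 ?expR_ge0.
have q0 : 0 <= q by have := quadratic_ge0 (l * s); rewrite /q; lra.
rewrite /trunc_exp; case: ifPn => [sw|_]; last exact: addr_ge0.
have [r1|r1] := leP (l * s) 1.
  by have := expR_le_quadratic r1; rewrite exprMn mulrA -/q; lra.
have lw : l * s <= l * w by rewrite ler_wpM2l// ltW.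
have [|[|k] _] := @grid_cell _ 1 (l * s) (Num.truncn (l * s)).+1; rewrite !mulr1.
- by rewrite (lt_trans ltr01 r1) ltW// truncnS_gt.
- by move=> /andP[_ /(lt_le_trans r1)]; rewrite ltxx.
move=> /andP[ks sk]; have kw : (k < Num.truncn (l * w))%N.
  by rewrite truncn_ge_nat ?(le_trans (ltW ks))// (le_trans (ltW (lt_trans ltr01 r1))).
apply: (@le_trans _ _ layers); last by rewrite lerDr.
rewrite /layers (bigD1 (Ordinal kw)) //= ltr_pdivrMr// [s * l]mulrC ks mulr1.
apply: le_trans (_ : expR k.+2%:R <= _); first by rewrite ler_expR.
by rewrite lerDl sumr_ge0// => j _; rewrite mulr_ge0 ?expR_ge0.
Qed.

Lemma sum_layers_le (R : realType) (F : R -> R) (l w B : R) : 0 < l -> 0 <= B ->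
  (forall t, l^-1 <= t <= w -> expR (l * t) * F t <= B * t ^- 2) ->
  \sum_(k < Num.truncn (l * w)) expR k.+2%:R * F (k.+1%:R / l) <= 2 * expR 1 * B * l ^+ 2.
Proof.
move=> l0 B0 tail.
apply: le_trans (_ : _ <= expR 1 * B * l ^+ 2 * \sum_(k < Num.truncn (l * w)) k.+1%:R ^- 2) _.
  rewrite mulr_sumr; apply: ler_sum => k _; set t := k.+1%:R / l.
  have lt : l * t = k.+1%:R by rewrite /t mulrC divfK// gt_eqF.
  have lw1 : 1 <= l * w by rewrite -truncn_gt0; exact: leq_ltn_trans (ltn_ord k).
  have tail_t : expR (l * t) * F t <= B * t ^- 2.
    apply: tail; apply/andP; split.
      by rewrite /t -[leLHS]mul1r ler_wpM2r ?invr_ge0 ?(ltW l0) ?ler1n.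
    by rewrite ler_pdivrMr// [w * l]mulrC -truncn_ge_nat ?(le_trans _ lw1).
  rewrite (_ : k.+2%:R = 1 + l * t); last by rewrite lt -natr1 addrC.
  rewrite expRD -!mulrA ler_wpM2l ?expR_ge0//.
  by apply: le_trans tail_t _; rewrite ler_wpM2l// /t expr_div_n invf_div mulrA.
have -> : 2 * expR 1 * B * l ^+ 2 = expR 1 * B * l ^+ 2 * 2 by ring.
by rewrite ler_wpM2l ?sum_inv_sqr_le2// mulr_ge0 ?sqr_ge0// mulr_ge0 ?expR_ge0.
Qed.

Definition second_moment d (T : measurableType d) (R : realType) (P : probability T R)
  (X : nat -> {RV P >-> R}) : R := fine (\int[P]_w (X 0%N w ^+ 2)%:E)%E.

Section Moments.
Context {d : measure_display} {T : measurableType d} {R : realType}.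
Variables (P : probability T R) (X : nat -> {RV P >-> R}) (a : R).
Hypotheses (idX : identically_distributed X)
  (intX : P.-integrable setT (EFin \o X 0%N))
  (meanX : ('E_P[X 0%N] = (- a)%:E)%E)
  (intX2 : P.-integrable setT (EFin \o (fun w => X 0%N w ^+ 2))).

Let m2 := second_moment X.

Lemma second_moment_ge0 : 0 <= m2.
Proof. by rewrite fine_ge0// integral_ge0// => w _; rewrite lee_fin sqr_ge0. Qed.

Lemma integral_identical i (f : R -> R) : measurable_fun setT f -> (forall x, 0 <= f x) ->
  (\int[P]_w (f (X i w))%:E = \int[P]_w (f (X 0%N w))%:E)%E.
Proof.
move=> mf f0.
have mEf : measurable_fun setT (EFin \o f) by exact/measurable_EFinP.
rewrite -[LHS]/(\int[P]_w ((EFin \o f) \o X i) w)%E.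
rewrite -[RHS]/(\int[P]_w ((EFin \o f) \o X 0%N) w)%E -!ge0_integral_distribution//.
by apply: eq_measure_integral => A mA _; exact: idX.
Qed.

Lemma integral_quadratic (c0 c1 c2 : R) :
  (\int[P]_w (c0 + c1 * X 0%N w + c2 * X 0%N w ^+ 2)%:E = (c0 - c1 * a + c2 * m2)%:E)%E.
Proof.
have i0 : P.-integrable setT (fun w => c0%:E) by exact: finite_measure_integrable_cst.
have i1 : P.-integrable setT (fun w => (c1%:E * (X 0%N w)%:E)%E) by exact: integrableZl.
have i2 : P.-integrable setT (fun w => (c2%:E * (X 0%N w ^+ 2)%:E)%E) by exact: integrableZl.
under eq_integral do rewrite EFinD EFinD !EFinM.
rewrite integralD//; last exact: integrableD.
rewrite integralD// integral_constant integralZl// integralZl//.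
have -> : (\int[P]_w (X 0%N w)%:E = (- a)%:E)%E by rewrite -meanX unlock.
have -> : (\int[P]_w (X 0%N w ^+ 2)%:E = m2%:E)%E.
  by rewrite /m2 /second_moment fineK//; exact: (integrable_fin_num measurableT intX2).
by rewrite -!EFinM -!EFinD mulrN.
Qed.

Lemma centered_second_moment i u :
  (\int[P]_w ((u + (X i w + a)) ^+ 2)%:E <= (u ^+ 2 + m2)%:E)%E.
Proof.
rewrite (@integral_identical i (fun x => (u + (x + a)) ^+ 2)); last 2 first.
- by apply: measurable_funX; apply: measurable_funD => //; exact: measurable_funD.
- by move=> x; exact: sqr_ge0.
rewrite (eq_integral (fun w =>
  ((u + a) ^+ 2 + (2 * (u + a)) * X 0%N w + 1 * X 0%N w ^+ 2)%:E)); last first.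
  by move=> w _; congr EFin; ring.
rewrite integral_quadratic lee_fin.
by have := sqr_ge0 a; lra.
Qed.

Lemma integral_layers_le l w : 0 < l ->
  (\int[P]_v (trunc_exp l w (X 0%N v))%:E <= (1 - l * a + 2 * l ^+ 2 * m2 +
     \sum_(k < Num.truncn (l * w)) expR k.+2%:R * Fbar X (k.+1%:R / l))%:E)%E.
Proof.
move=> l0; pose q v : R := 1 + l * X 0%N v + 2 * l ^+ 2 * X 0%N v ^+ 2.
pose layer k v : R := expR k.+2%:R * \1_(jump X (k.+1%:R / l) 0) v.
have q0 v : 0 <= q v by have := quadratic_ge0 (l * X 0%N v); rewrite /q; lra.
have mq : measurable_fun setT (EFin \o q).
  apply/measurable_EFinP; apply: measurable_funD; first apply: measurable_funD => //.
    exact: measurable_funM.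
  by apply: measurable_funM => //; exact: measurable_funX.
have layer0 k v : 0 <= layer k v by rewrite mulr_ge0 ?expR_ge0.
have mlayer k : measurable_fun setT (EFin \o layer k).
  apply/measurable_EFinP; apply: measurable_funM => //.
  by apply: measurable_indic; exact: measurable_jump.
have int_layer k : (\int[P]_v (layer k v)%:E = (expR k.+2%:R * Fbar X (k.+1%:R / l))%:E)%E.
  rewrite /layer; under eq_integral do rewrite EFinM.
  have mjump := measurable_jump X (k.+1%:R / l) 0.
  rewrite ge0_integralZl ?lee_fin ?expR_ge0//; last by apply/measurable_EFinP.
  by rewrite integral_indic// setIT EFinM -/(pr P (jump X (k.+1%:R / l) 0)) -prE.
apply: (@le_trans _ _ (\int[P]_v ((q v)%:E + \sum_(k < Num.truncn (l * w)) (layer k v)%:E))%E).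
  apply: ge0_le_integral => //.
  - by move=> v _; rewrite lee_fin trunc_exp_ge0.
  - by apply/measurable_EFinP; apply: measurableT_comp => //; exact: measurable_trunc_exp.
  - by apply: emeasurable_funD => //; apply: emeasurable_sum => k; exact: mlayer.
  move=> v _; rewrite sumEFin -EFinD lee_fin.
  apply: le_trans (trunc_exp_le_layers w (X 0%N v) l0) _; rewrite lerD2l.
  apply: ler_sum => k _; rewrite /layer indicE.
  by have <- : (v \in jump X (k.+1%:R / l) 0) = (k.+1%:R / l < X 0%N v)
    by apply/idP/idP => [/set_mem|/mem_set].
rewrite ge0_integralD//; last 3 first.
- by move=> v _; rewrite lee_fin.
- by move=> v _; apply: sume_ge0 => k _; rewrite lee_fin.
- by apply: emeasurable_sum => k; exact: mlayer.
rewrite ge0_integral_sum//; last 2 first.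
- by move=> k; exact: mlayer.
- by move=> k v _; rewrite lee_fin.
rewrite integral_quadratic; under eq_bigr do rewrite int_layer.
by rewrite sumEFin -EFinD.
Qed.

Lemma truncated_mgf_bound_of_tail t0 lam y B : 0 < t0 -> lam <= t0^-1 -> 0 <= B ->
  (forall t, t0 <= t <= y -> expR (lam * t) * Fbar X t <= B * t ^- 2) ->
  truncated_mgf_bound X a (2 * m2 + 2 * expR 1 * B) lam y.
Proof.
move=> t00 lam_t0 B0 tail i u /andP[]; rewrite le_eqVlt => /orP[/eqP <- _|u0 u_lam].
  rewrite expr0n /= !mulr0 oppr0 addr0 expR0 -(integral_constant P 1).
  apply: ge0_le_integral => //.
  - by move=> w _; rewrite lee_fin trunc_exp_ge0.
  - by apply/measurable_EFinP; apply: measurableT_comp => //; exact: measurable_trunc_exp.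
  - by move=> w _; rewrite lee_fin /trunc_exp mul0r expR0; case: ifP.
rewrite (integral_identical i (measurable_trunc_exp u y) (trunc_exp_ge0 u y)).
apply: le_trans (integral_layers_le y u0) _; rewrite lee_fin.
have layers : \sum_(k < Num.truncn (u * y)) expR k.+2%:R * Fbar X (k.+1%:R / u) <=
    2 * expR 1 * B * u ^+ 2.
  apply: sum_layers_le => // t /andP[ut ty].
  have t0t : t0 <= t.
    apply: le_trans ut; rewrite -[t0]invrK lef_pV2 ?posrE ?invr_gt0//.
    exact: le_trans u_lam lam_t0.
  apply: (le_trans _ (tail t _)); last by rewrite t0t.
  by rewrite ler_wpM2r ?Fbar_ge0// ler_expR ler_wpM2r// (le_trans (ltW t00)).
by apply: le_trans (expR_ge1Dx _); move: layers; set s := \sum_(_ < _) _; lra.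
Qed.

End Moments.

(** * Growth at infinity *)

Section Growth.
Context {R : realType}.
Implicit Types (a e M x y : R) (Q : R -> Prop).

Definition jump_size a x : R := Num.sqrt (2 * a * x).

Lemma near_pinfty_threshold Q m : (\forall x \near +oo, Q x) ->
  exists2 M, m <= M & forall x, M <= x -> Q x.
Proof.
move=> [M [_ h]]; exists (Num.max m (M + 1)); first by rewrite le_max lexx.
by move=> x; rewrite ge_max => /andP[_ Mx]; apply: h; lra.
Qed.

Lemma near_powR_ge e M : 0 < e -> \forall x \near +oo, M <= x `^ e.
Proof.
move=> e0; near=> x.
have x0 : 0 <= x by near: x; apply: nbhs_pinfty_ge; exact: num_real.
have xM : `|M| `^ e^-1 <= x by near: x; apply: nbhs_pinfty_ge; exact: num_real.
have := ge0_ler_powR (ltW e0) (powR_ge0 _ _) x0 xM.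
rewrite -powRrM mulVf ?gt_eqF// powRr1//.
by apply: le_trans; exact: ler_norm.
Unshelve. all: by end_near. Qed.

Lemma near_ln_ge M : \forall x \near +oo, M <= ln x.
Proof.
near=> x; have xM : expR M <= x by near: x; apply: nbhs_pinfty_ge; exact: num_real.
by rewrite -[leLHS]expRK ler_ln ?posrE ?expR_gt0// (lt_le_trans (expR_gt0 _) xM).
Unshelve. all: by end_near. Qed.

Lemma jump_sizeE a x : 0 <= a -> jump_size a x = Num.sqrt (2 * a) * Num.sqrt x.
Proof. by move=> a0; rewrite /jump_size sqrtrM// mulr_ge0. Qed.

Lemma jump_size_ge0 a x : 0 <= jump_size a x.
Proof. exact: sqrtr_ge0. Qed.

Lemma sqr_jump_size a x : 0 <= a -> 0 <= x -> jump_size a x ^+ 2 = 2 * a * x.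
Proof. by move=> a0 x0; rewrite sqr_sqrtr// !mulr_ge0. Qed.

Lemma near_jump_size a Q : 0 < a -> (\forall y \near +oo, Q y) ->
  \forall x \near +oo, Q (jump_size a x).
Proof.
move=> a0 /near_pinfty_threshold-/(_ 0)[M _ QM]; near=> x; apply: QM.
apply: (le_trans (ler_norm M)); rewrite -sqrtr_sqr ler_wsqrtr//.
by rewrite mulrC -ler_pdivrMr ?mulr_gt0.
Unshelve. all: by end_near. Qed.

Lemma near_jump_size_ge a M : 0 < a -> \forall x \near +oo, M <= jump_size a x.
Proof.
move=> a0; apply: (near_jump_size (Q := fun y => M <= y)) => //.
by apply: nbhs_pinfty_ge; exact: num_real.
Qed.

Lemma root4X x : 0 <= x -> (x `^ 4^-1) ^+ 4 = x.
Proof. by move=> x0; rewrite -powR_mulrn ?powR_ge0// -powRrM mulVf// powRr1. Qed.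

Lemma root4_sqr x : 0 <= x -> (x `^ 4^-1) ^+ 2 = Num.sqrt x.
Proof.
move=> x0; rewrite -[in RHS](root4X x0) (exprM _ 2 2) sqrtr_sqr ger0_norm//.
by rewrite exprn_ge0// powR_ge0.
Qed.

Lemma truncnS_itv (q : R) : 0 <= q -> q <= (Num.truncn q).+1%:R <= q + 1.
Proof.
by move=> /truncn_itv/andP[qn nq]; rewrite (ltW nq) -natr1 lerD2r.
Qed.

Lemma sqrt_subr_ge x e : 0 < x -> 0 <= e <= x ->
  Num.sqrt x - e / Num.sqrt x <= Num.sqrt (x - e).
Proof.
move=> x0 /andP[e0 ex]; set s := Num.sqrt x.
have s0 : 0 < s by rewrite sqrtr_gt0.
have s2 : s ^+ 2 = x by rewrite sqr_sqrtr// ltW.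
apply: (le_trans (ler_norm _)); rewrite -sqrtr_sqr ler_wsqrtr//.
have -> : (s - e / s) ^+ 2 = s ^+ 2 - 2 * e + e * (e / s ^+ 2) by field; rewrite gt_eqF.
rewrite s2; have : e * (e / x) <= e * 1 by rewrite ler_wpM2l// ler_pdivrMr// mul1r.
lra.
Qed.

Lemma asymp_two_sided (f h : R -> R) : (\forall x \near +oo, 0 < h x) ->
  (fun x => f x / h x) @ +oo --> (1 : R) ->
  \forall x \near +oo, h x / 2 <= f x <= 2 * h x.
Proof.
move=> h_pos /cvgrPdist_lt/(_ 2^-1) fh; near=> x.
have hx : 0 < h x by near: x.
have : `|1 - f x / h x| < 2^-1 by near: x; apply: fh; rewrite invr_gt0.
rewrite ltr_norml => /andP[lower upper].
have ratio_itv : 2^-1 <= f x / h x <= 2 by apply/andP; split; lra.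
by move: ratio_itv; rewrite ler_pdivlMr// ler_pdivrMr// [2^-1 * _]mulrC.
Unshelve. all: by end_near. Qed.

End Growth.

Section Rate.
Context {R : realType}.
Variable g : R -> R.
Hypotheses (g_decr : forall x y, 0 < x -> x <= y -> g y / y <= g x / x)
  (g_lim : (fun x => g x / x) @ +oo --> (0 : R)).

Definition tail_model (t : R) : R := expR (- g t) * t ^- 2.

Lemma rate_ge0 x : 0 < x -> 0 <= g x.
Proof.
move=> x0; suff : 0 <= g x / x by rewrite ler_pdivlMr// mul0r.
rewrite leNgt; apply/negP => gx.
have /cvgrPdist_lt /(_ (- (g x / x))) := g_lim; rewrite oppr_gt0 => /(_ gx).
move=> /near_pinfty_threshold-/(_ x)[M xM /(_ M (lexx M))].
have := g_decr x0 xM; rewrite sub0r normrN => decr near0.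
have := ler_norm (- (g M / M)); rewrite normrN; lra.
Qed.

Lemma near_rate_le e : 0 < e -> \forall x \near +oo, g x / x <= e.
Proof.
move=> e0; have /cvgrPdist_lt /(_ e e0) near0 := g_lim.
near=> x; have : `|0 - g x / x| < e by near: x.
by rewrite sub0r normrN => /ltW; apply: le_trans; exact: ler_norm.
Unshelve. all: by end_near. Qed.

Lemma rate_chord t y : 0 < t -> t <= y -> g y / y * t <= g t.
Proof. by move=> t0 ty; rewrite -ler_pdivlMr//; exact: g_decr. Qed.

Lemma tail_model_gt0 t : 0 < t -> 0 < tail_model t.
Proof. by move=> t0; rewrite mulr_gt0 ?expR_gt0// invr_gt0 exprn_gt0. Qed.

(** [g] lies above its chords through the origin, which compensates an exponential tilt. *)
Lemma tilted_tail_model_le y t s : 0 < t -> t <= y -> s <= t ->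
  expR (g y / y * s) * tail_model t <= t ^- 2.
Proof.
move=> t0 ty st; have y0 : 0 < y by exact: lt_le_trans ty.
rewrite mulrA -expRD -[leRHS]mul1r ler_wpM2r ?invr_ge0 ?exprn_ge0 ?(ltW t0)//.
rewrite -expR0 ler_expR subr_le0 (le_trans _ (rate_chord t0 ty))//.
by rewrite ler_wpM2l// divr_ge0 ?rate_ge0 ?ltW.
Qed.

Lemma tail_model_le t : 0 < t -> tail_model t <= t ^- 2.
Proof.
move=> t0; have := tilted_tail_model_le t0 (lexx t) (ltW t0).
by rewrite mulr0 expR0 mul1r.
Qed.

Lemma ln_tail_model (c u y : R) : 0 < c -> 0 < y ->
  ln (c * (expR (- u) * y ^- 2)) = ln c - u - 2 * ln y.
Proof.
move=> c0 y0; have y2 : 0 < y ^+ 2 by rewrite exprn_gt0.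
rewrite lnM ?posrE ?mulr_gt0 ?expR_gt0 ?invr_gt0//.
rewrite lnM ?posrE ?expR_gt0 ?invr_gt0// expRK lnV ?posrE// lnXn// -mulr_natl.
by ring.
Qed.

End Rate.

(** * Tail asymptotics of the area *)

Section Asymptotics.
Context {d : measure_display} {T : measurableType d} {R : realType}.
Variables (P : probability T R) (X : nat -> {RV P >-> R}) (a : R) (g : R -> R) (t0 : R).
Hypotheses (iidX : iid X) (a0 : 0 < a)
  (intX : P.-integrable setT (EFin \o X 0%N))
  (meanX : ('E_P[X 0%N] = (- a)%:E)%E)
  (intX2 : P.-integrable setT (EFin \o (fun w => X 0%N w ^+ 2)))
  (g_decr : forall x y, 0 < x -> x <= y -> g y / y <= g x / x)
  (g_lim : (fun x => g x / x) @ +oo --> (0:R))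
  (t0_ge1 : 1 <= t0)
  (Fbar_tail : forall t, t0 <= t -> tail_model g t / 2 <= Fbar X t <= 2 * tail_model g t).

Let m2 := second_moment X.
Let t0_gt0 : 0 < t0. Proof. exact: lt_le_trans t0_ge1. Qed.

Definition mgf_const : R := 2 * m2 + 2 * expR 1 * 2.

Lemma mgf_const_gt0 : 0 < mgf_const.
Proof.
by rewrite /mgf_const ltr_wpDl ?mulr_gt0 ?expR_gt0// mulr_ge0// second_moment_ge0.
Qed.

Lemma Fbar_gt0 t : t0 <= t -> 0 < Fbar X t.
Proof.
move=> t0t; have /andP[+ _] := Fbar_tail t0t; apply: lt_le_trans.
by rewrite divr_gt0// tail_model_gt0// (lt_le_trans t0_gt0).
Qed.

Lemma Fbar_le_tail t : t0 <= t -> Fbar X t <= 2 * tail_model g t.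
Proof. by move=> /Fbar_tail/andP[]. Qed.

Lemma Fbar_le_inv_sqr t : t0 <= t -> Fbar X t <= 2 * t ^- 2.
Proof.
move=> t0t; apply: le_trans (Fbar_le_tail t0t) _.
by rewrite ler_wpM2l// (tail_model_le g_decr g_lim)// (lt_le_trans t0_gt0).
Qed.

Lemma natmul_Fbar_le n (k y : R) : t0 <= y -> n%:R <= k * y -> 2 * k <= y ->
  n%:R * Fbar X y <= expR (- g y).
Proof.
move=> t0y nk ky; have y0 : 0 < y by exact: lt_le_trans t0y.
apply: le_trans (ler_pM (ler0n _ _) (Fbar_ge0 X y) nk (Fbar_le_tail t0y)) _.
have -> : k * y * (2 * tail_model g y) = expR (- g y) * (2 * k / y).
  by rewrite /tail_model; field; rewrite gt_eqF.
by rewrite -[leRHS]mulr1 ler_wpM2l ?expR_ge0// ler_pdivrMr// mul1r.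
Qed.

Lemma truncated_mgf_bound_rate y : 0 < y -> g y / y <= t0^-1 ->
  truncated_mgf_bound X a mgf_const (g y / y) y.
Proof.
move=> y0 lam_t0; apply: truncated_mgf_bound_of_tail t0_gt0 lam_t0 _ _ => //.
  exact: iidX.2.
move=> t /andP[t0t ty]; have tp : 0 < t by exact: lt_le_trans t0t.
apply: le_trans (ler_wpM2l (expR_ge0 _) (Fbar_le_tail t0t)) _.
by rewrite mulrCA ler_wpM2l// (tilted_tail_model_le g_decr g_lim).
Qed.

Lemma truncated_mgf_bound_low lam b : 0 <= lam <= t0^-1 ->
  truncated_mgf_bound X a (2 * m2 + 2 * expR 1 * (2 * expR (lam * b))) lam b.
Proof.
move=> /andP[lam0 lam_t0]; apply: truncated_mgf_bound_of_tail t0_gt0 lam_t0 _ _ => //.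
  exact: iidX.2.
move=> t /andP[t0t tb]; rewrite [2 * _]mulrC -mulrA; apply: ler_pM.
- exact: expR_ge0.
- exact: Fbar_ge0.
- by rewrite ler_expR ler_wpM2l.
- exact: Fbar_le_inv_sqr.
Qed.

(** ** The upper bound *)

Let scale := Num.sqrt (2 * a).
Let window_const := 2 * scale / a + 1.

Let scale_gt0 : 0 < scale. Proof. by rewrite sqrtr_gt0 mulr_gt0. Qed.

Let window_const_ge0 : 0 <= window_const.
Proof. by rewrite addr_ge0 ?divr_ge0 ?mulr_ge0 ?(ltW scale_gt0) ?(ltW a0). Qed.

(** The first [m * W] times are cut into [m] windows of [W] times, both of order
    [x ^ (1/4)]. *)
Lemma window_parameters x : 0 <= x -> 1 <= x `^ 4^-1 -> 2 * a + 1 <= x `^ 4^-1 ->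
  exists m W, [/\ (0 < m)%N, (0 < W)%N, m%:R <= window_const * x `^ 4^-1,
    2 * jump_size a x / a <= (m * W)%:R <= 2 * window_const / scale * jump_size a x &
    a * W%:R ^+ 2 / 2 <= 2 * a * Num.sqrt x <= x].
Proof.
move=> x0; set q := x `^ 4^-1 => q1 qa.
have q2 : q ^+ 2 = Num.sqrt x by exact: root4_sqr.
have q4 : q ^+ 4 = x by exact: root4X.
have yE : jump_size a x = scale * q ^+ 2 by rewrite jump_sizeE ?q2// ltW.
(* [lra] ignores section hypotheses. *)
have s0 := scale_gt0; have c0 := window_const_ge0.
have q0 : 0 <= q by lra.
pose b := 2 * scale * q / a.
have b0 : 0 <= b by rewrite divr_ge0 ?mulr_ge0 ?(ltW s0) ?(ltW a0).
have /andP[W_ge W_le] := truncnS_itv q0; have /andP[m_ge m_le] := truncnS_itv b0.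
exists (Num.truncn b).+1, (Num.truncn q).+1.
move: (Num.truncn b) (Num.truncn q) m_ge m_le W_ge W_le => m W m_ge m_le W_ge W_le.
have cq : window_const * q = b + q by rewrite /window_const /b; field; rewrite gt_eqF.
have mc : m.+1%:R <= window_const * q by rewrite cq; lra.
split=> //; first rewrite natrM yE; apply/andP; split.
- apply: (@le_trans _ _ (b * q)); last exact: ler_pM.
  by apply: eq_implies_le; rewrite /b; field; rewrite gt_eqF.
- apply: (@le_trans _ _ (window_const * q * (2 * q))); first by apply: ler_pM => //; lra.
  by apply: eq_implies_le; field; rewrite gt_eqF.
- have : W.+1%:R ^+ 2 <= (2 * q) ^+ 2 by rewrite ler_pXn2r ?nnegrE ?mulr_ge0//; lra.
  by rewrite -q2 exprMn => /(ler_wpM2l (ltW a0)); lra.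
- have aq : 2 * a <= q ^+ 2.
    by apply: (@le_trans _ _ q); [lra|rewrite expr2 ler_peMr].
  by rewrite -q2 -[leRHS]q4 (exprD _ 2 2) ler_wpM2r ?sqr_ge0.
Qed.

Let window_loss := 4 * a * Num.sqrt (a / 2) + a / 2.

Lemma window_exponent_ge C lam x e : 0 <= C -> 0 <= lam <= 1 ->
  0 <= a / 2 - C * lam -> 0 < x -> 0 <= e <= 2 * a * Num.sqrt x -> e <= x ->
  lam * (jump_size a x * Num.sqrt (1 - 2 * C * lam / a)) - window_loss <=
  lam * (2 * Num.sqrt ((x - e) * (a / 2 - C * lam)) - a / 2).
Proof.
move=> C0 /andP[l0 l1] c0 x0 /andP[e0 ea] ex.
have sqrt_x : Num.sqrt x - 2 * a <= Num.sqrt (x - e).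
  apply: le_trans (sqrt_subr_ge x0 _); last by rewrite e0.
  by rewrite lerD2l lerN2 ler_pdivrMr ?sqrtr_gt0.
have <- : 2 * Num.sqrt x * Num.sqrt (a / 2 - C * lam) =
    jump_size a x * Num.sqrt (1 - 2 * C * lam / a).
  rewrite -[RHS]sqrtrM; last by rewrite !mulr_ge0 ?(ltW a0) ?(ltW x0).
  rewrite (_ : 2 * a * x * _ = 2 ^+ 2 * x * (a / 2 - C * lam)); last first.
    by field; rewrite gt_eqF.
  rewrite sqrtrM; last by rewrite mulr_ge0 ?(ltW x0) ?sqr_ge0.
  by rewrite sqrtrM// sqrtr_sqr ger0_norm.
have root_le : Num.sqrt (a / 2 - C * lam) <= Num.sqrt (a / 2).
  by rewrite ler_wsqrtr//; have := mulr_ge0 C0 l0; lra.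
have prod_le : (Num.sqrt x - 2 * a) * Num.sqrt (a / 2 - C * lam) <=
    Num.sqrt ((x - e) * (a / 2 - C * lam)).
  by rewrite sqrtrM ?subr_ge0// ler_wpM2r ?sqrtr_ge0.
have : 2 * a * Num.sqrt (a / 2 - C * lam) <= 2 * a * Num.sqrt (a / 2).
  by rewrite ler_wpM2l// mulr_ge0// ltW.
move: root_le prod_le (sqrtr_ge0 (a / 2)); rewrite /window_loss.
move: (Num.sqrt x) (Num.sqrt (a / 2 - C * lam)) (Num.sqrt (a / 2))
   (Num.sqrt ((x - e) * (a / 2 - C * lam))) => u v w z vw uvz w0 avw.
have loss0 : 0 <= 4 * a * w + a / 2 by rewrite addr_ge0 ?divr_ge0 ?mulr_ge0 ?(ltW a0).
have : lam * (2 * u * v - (4 * a * w + a / 2)) <= lam * (2 * z - a / 2).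
  by rewrite ler_wpM2l//; lra.
have : lam * (4 * a * w + a / 2) <= 1 * (4 * a * w + a / 2) by rewrite ler_wpM2r.
lra.
Qed.

Lemma le_drift_mul c y (n : R) : 0 <= y -> 0 <= a / 2 - c -> 2 * y / a <= n ->
  y <= (a - c) * n.
Proof.
move=> y0 c0 yn; have a_gt0 := a0; have -> : y = a / 2 * (2 * y / a) by field; rewrite gt_eqF.
by apply: ler_pM => //; rewrite ?divr_ge0 ?mulr_ge0 ?(ltW a0)//; lra.
Qed.

Definition upper_bound_const : R := 2 + window_const * expR window_loss.

Lemma upper_bound_const_gt0 : 0 < upper_bound_const.
Proof. by rewrite ltr_wpDr ?mulr_ge0 ?expR_ge0. Qed.

Lemma PAtau_gt_le_windows x : let y := jump_size a x in let lam := g y / y in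
  1 <= x -> 2 * a + 1 <= x `^ 4^-1 -> t0 <= y -> 2 * (2 * window_const / scale) <= y ->
  lam <= t0^-1 -> mgf_const * lam <= a / 2 ->
  PAtau_gt X x <= upper_bound_const * x `^ 4^-1 *
    expR (- (g y * Num.sqrt (1 - 2 * mgf_const * g y / (a * y)))).
Proof.
move=> y lam x1 qa t0y cy lam_t0 lam_a; have a_gt0 := a0; have c0 := mgf_const_gt0.
have x0 : 0 < x by exact: lt_le_trans x1.
have y0 : 0 < y by exact: lt_le_trans t0y.
have gy0 : 0 <= g y by exact: rate_ge0 g_lim _ _.
have lam0 : 0 <= lam by rewrite divr_ge0// ltW.
have lam1 : lam <= 1 by apply: le_trans lam_t0 _; rewrite invf_le1.
have gE : g y = lam * y by rewrite divfK// gt_eqF.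
set q := x `^ 4^-1 in qa *; set E := expR _.
have q1 : 1 <= q by lra.
have [m [W [m0 W0 mq /andP[nlow nup] /andP[Wlow Wup]]]] := window_parameters (ltW x0) q1 qa.
have expE : expR (- g y) <= E.
  rewrite ler_expR lerN2 -[leRHS]mulr1 ler_wpM2l// -[leRHS]sqrtr1 ler_wsqrtr//.
  by rewrite lerBlDr lerDl divr_ge0 ?mulr_ge0 ?(ltW c0) ?(ltW a0) ?(ltW y0).
have slack : 0 <= a / 2 - mgf_const * lam by rewrite subr_ge0.
apply: (@le_trans _ _ (pr P (large_area X 0 x (m * W)))).
  apply: pr_le; [exact: measurable_Atau_gt|exact: measurable_large_area|].
  by apply: Atau_gt_large_area; rewrite muln_gt0 m0.
have jumpF i : pr P (jump X y i) <= Fbar X y by rewrite (pr_jump _ _ iidX.2).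
have Wx : 0 <= x - a * W%:R ^+ 2 / 2 by rewrite subr_ge0 (le_trans Wlow).
apply: le_trans (pr_large_area 0 m iidX.1 (truncated_mgf_bound_rate y0 lam_t0) jumpF
  a0 (ltW c0) lam0 slack W0 Wx) _.
have jumps_le : (m * W)%:R * Fbar X y <= E.
  by apply: le_trans expE; exact: natmul_Fbar_le nup cy.
have survival_le : expR (lam * (0 - (a - mgf_const * lam) * (m * W)%:R)) <= E.
  apply: le_trans expE; rewrite ler_expR gE sub0r mulrN lerN2 ler_wpM2l//.
  by apply: le_drift_mul nlow => //; exact: ltW.
have windows_le : m%:R * expR (- (lam * (2 * Num.sqrt ((x - a * W%:R ^+ 2 / 2) *
    (a / 2 - mgf_const * lam)) - 0 - a / 2))) <= window_const * q * (expR window_loss * E).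
  apply: ler_pM => //; rewrite ?expR_ge0// -expRD ler_expR subr0 lerNl opprD opprK addrC.
  have -> : g y * Num.sqrt (1 - 2 * mgf_const * g y / (a * y)) =
      lam * (y * Num.sqrt (1 - 2 * mgf_const * lam / a)).
    by rewrite gE [RHS]mulrA; congr (_ * Num.sqrt _); field; rewrite !gt_eqF.
  apply: window_exponent_ge => //; rewrite ?lam0 ?(ltW c0)//; last exact: le_trans Wup.
  by rewrite Wlow andbT divr_ge0 ?mulr_ge0 ?(ltW a0) ?sqr_ge0.
apply: (le_trans (lerD jumps_le (lerD windows_le survival_le))).
have : 2 * E <= 2 * q * E by rewrite ler_wpM2r ?expR_ge0// ler_peMr.
by rewrite /upper_bound_const; lra.
Qed.

Lemma area_tail_upper : exists C, 0 < C /\ \forall x \near +oo,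
  PAtau_gt X x <= C * x `^ 4^-1 *
    expR (- (g (jump_size a x) *
      Num.sqrt (1 - 2 * C * g (jump_size a x) / (a * jump_size a x)))).
Proof.
have c0 := mgf_const_gt0; have C0 := upper_bound_const_gt0.
exists (mgf_const + upper_bound_const); split; first exact: addr_gt0.
have t0V_gt0 : 0 < t0^-1 by rewrite invr_gt0.
have slack_gt0 : 0 < a / 2 / mgf_const by rewrite !divr_gt0.
near=> x; set y := jump_size a x.
have x1 : 1 <= x by near: x; apply: nbhs_pinfty_ge; exact: num_real.
have qa : 2 * a + 1 <= x `^ 4^-1 by near: x; exact: near_powR_ge.
have t0y : t0 <= y by rewrite /y; near: x; exact: near_jump_size_ge.
have cy : 2 * (2 * window_const / scale) <= y.
  by rewrite /y; near: x; exact: near_jump_size_ge.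
have lam_t0 : g y / y <= t0^-1.
  by rewrite /y; near: x; exact: near_jump_size a0 (near_rate_le g_lim t0V_gt0).
have lam_a : g y / y <= a / 2 / mgf_const.
  by rewrite /y; near: x; exact: near_jump_size a0 (near_rate_le g_lim slack_gt0).
have y0 : 0 < y by exact: lt_le_trans t0y.
have gy0 : 0 <= g y by exact: rate_ge0 g_lim _ _.
apply: le_trans (PAtau_gt_le_windows x1 qa t0y cy lam_t0 _) _.
  by rewrite mulrC -ler_pdivlMr.
apply: ler_pM; rewrite ?expR_ge0 ?mulr_ge0 ?powR_ge0 ?(ltW C0)//.
  by rewrite ler_wpM2r ?powR_ge0// lerDr ltW.
rewrite ler_expR lerN2 ler_wpM2l// ler_wsqrtr// lerD2l lerN2 ler_wpM2r//.
  by rewrite invr_ge0 mulr_ge0 ?(ltW a0) ?(ltW y0).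
by rewrite ler_wpM2r// ler_wpM2l// lerDl ltW.
Unshelve. all: by end_near. Qed.

(** ** The lower bound *)

Lemma pr_small_fluctuation_ge k m L : 0 < L ->
  1 - m%:R * m2 / L ^+ 2 <= pr P (small_fluctuation (shifted X k.+1) a L m).
Proof.
move=> L0; have mS := measurable_small_fluctuation (shifted X k.+1) a L m.
have : pr P (~` small_fluctuation (shifted X k.+1) a L m) <= m%:R * m2 / L ^+ 2.
  apply: (@kolmogorov_inequality _ _ _ _ (shifted X k.+1) a m2 L m) => //.
  - exact/shift_independent/iidX.1.
  - exact: second_moment_ge0.
  - by move=> i u; exact: (centered_second_moment iidX.2 intX meanX intX2).
  - exact: measurableC.
  - by move=> w /existsNP[j /not_implyP[jm /negP]]; rewrite -leNgt => Lj; exists j.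
by rewrite pr_setC//; lra.
Qed.

Lemma pr_positive_until_le n : pr P (positive_until X n.+1) <= m2 / a ^+ 2 / n.+1%:R.
Proof.
have -> : m2 / a ^+ 2 / n.+1%:R = n.+1%:R * m2 / (n.+1%:R * a) ^+ 2.
  by have : (0 : R) < n.+1%:R by []; move: n.+1%:R => r r0; field; rewrite !gt_eqF.
apply: (@kolmogorov_inequality _ _ _ _ X a m2 _ n.+1).
- exact: iidX.1.
- exact: second_moment_ge0.
- by move=> i u; exact: (centered_second_moment iidX.2 intX meanX intX2).
- by rewrite mulr_gt0.
- exact: measurable_positive_until.
- move=> w pn; exists n.+1 => //; apply: le_trans (ler_norm _).
  by rewrite lerDr ltW//; exact: pn.
Qed.

Lemma near_Fbar_le e : 0 < e -> \forall z \near +oo, Fbar X z <= e.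
Proof.
move=> e0; near=> z.
have t0z : t0 <= z by near: z; apply: nbhs_pinfty_ge; exact: num_real.
have ez : 2 / e <= z by near: z; apply: nbhs_pinfty_ge; exact: num_real.
apply: le_trans (Fbar_le_inv_sqr t0z) _.
rewrite ler_pdivrMr ?exprn_gt0 ?(lt_le_trans ltr01)//.
apply: le_trans (_ : e * z <= _); first by rewrite mulrC -ler_pdivrMr.
by rewrite ler_wpM2l ?(ltW e0)// expr2 ler_peMr// (le_trans ler01).
Unshelve. all: by end_near. Qed.

(** Fluctuations of order [x ^ (1/4 + eps)] exceed those of the walk over a time of order
    [x ^ (1/2)]. *)
Lemma near_fluctuation_le eps b : 0 < eps -> 0 < b -> \forall x \near +oo,
  forall m, m%:R * a <= jump_size a x -> m%:R * m2 / (x `^ (4^-1 + eps)) ^+ 2 <= b.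
Proof.
move=> eps0 b0; near=> x => m my.
have x0 : 0 < x by near: x; apply: nbhs_pinfty_gt; exact: num_real.
have x_eps : Num.max 1 (scale * m2 / a / b) <= x `^ eps by near: x; exact: near_powR_ge.
have [eps1 epsb] : 1 <= x `^ eps /\ scale * m2 / a / b <= x `^ eps.
  by move: x_eps; rewrite ge_max => /andP.
have sqrt_gt0 : 0 < Num.sqrt x by rewrite sqrtr_gt0.
rewrite powRD; last by apply/implyP => _; rewrite gt_eqF.
rewrite exprMn root4_sqr ?(ltW x0)// ler_pdivrMr ?mulr_gt0 ?exprn_gt0 ?powR_gt0//.
apply: (@le_trans _ _ (jump_size a x / a * m2)).
  by rewrite ler_wpM2r ?second_moment_ge0// ler_pdivlMr.
have -> : jump_size a x / a * m2 = scale * m2 / a / b * (b * Num.sqrt x).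
  by rewrite jump_sizeE ?(ltW a0)// -/scale; field; rewrite !gt_eqF.
have -> : b * (Num.sqrt x * x `^ eps ^+ 2) = x `^ eps ^+ 2 * (b * Num.sqrt x) by ring.
rewrite ler_wpM2r ?mulr_ge0 ?(ltW b0) ?(ltW sqrt_gt0)// (le_trans epsb)//.
by rewrite expr2 ler_peMr// (le_trans ler01).
Unshelve. all: by end_near. Qed.

Lemma lower_product_ge (u F S N c : R) : 0 <= u -> 0 <= F -> 0 <= S -> 0 <= N ->
  u * (S + 1) <= (S - c) / 2 -> F * (N + 1) <= (S - c) / 2 ->
  c <= (1 - u) * (S - N * F).
Proof.
move=> u0 F0 S0 N0 uS FN; have : 0 <= u * (N * F) by rewrite !mulr_ge0.
lra.
Qed.

Lemma area_tail_lower eps c K : 0 < eps ->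
  c < \sum_(k < K) pr P (positive_until X k) -> \forall x \near +oo,
    c <= PAtau_gt X x / Fbar X (jump_size a x + 2 * x `^ (4^-1 + eps)).
Proof.
move=> eps0; set S := \sum_(k < K) _ => cS.
have S0 : 0 <= S by apply: sumr_ge0 => k _; exact: pr_ge0.
have S1 : 0 < S + 1 by exact: ltr_wpDl.
have N1 : 0 < K%:R ^+ 2 + 1 :> R by rewrite ltr_wpDl ?sqr_ge0.
have gap : 0 < (S - c) / 2 by rewrite divr_gt0// subr_gt0.
have b0 : 0 < Num.min 1 ((S - c) / 2 / (S + 1)) by rewrite lt_min ltr01 divr_gt0.
have [M t0M FbarM] := near_pinfty_threshold t0 (near_Fbar_le (divr_gt0 gap N1)).
near=> x; set y := jump_size a x; set L := x `^ (4^-1 + eps).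
have x0 : 0 < x by near: x; apply: nbhs_pinfty_gt; exact: num_real.
have yM : M <= y by rewrite /y; near: x; exact: near_jump_size_ge.
have L0 : 0 < L by exact: powR_gt0.
have y0 : 0 <= y by exact: jump_size_ge0.
pose m := Num.truncn (y / a).
have /andP[my ym] : m%:R * a <= y <= m.+1%:R * a.
  have /truncn_itv/andP[ml mu] : 0 <= y / a by rewrite divr_ge0// ltW.
  by rewrite -ler_pdivlMr// ml -ler_pdivrMr// ltW.
have fluct n : n%:R * a <= y -> n%:R * m2 / L ^+ 2 <= Num.min 1 ((S - c) / 2 / (S + 1)).
  by move: n; rewrite /y /L; near: x; exact: near_fluctuation_le.
have := fluct m my; rewrite le_min => /andP[fluct1 fluctS].
have fluct0 : 0 <= m%:R * m2 / L ^+ 2.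
  by rewrite divr_ge0 ?sqr_ge0// mulr_ge0// second_moment_ge0.
have [z zE] : exists z, z = y + 2 * L by exists (y + 2 * L).
rewrite -zE; have Mz : M <= z by rewrite zE (le_trans yM)// lerDl mulr_ge0// ltW.
have Fz0 : 0 < Fbar X z by exact/Fbar_gt0/(le_trans t0M).
rewrite ler_pdivlMr// mulrC; apply: le_trans (PAtau_gt_ge K iidX a0 L0 y0 _ _ _
  (fun k => pr_small_fluctuation_ge k m L0) zE).
- rewrite ler_wpM2l ?(ltW Fz0)// lower_product_ge ?sqr_ge0 ?(ltW Fz0)//.
  + by rewrite -ler_pdivlMr.
  + by rewrite -ler_pdivlMr//; exact: FbarM.
- by rewrite my.
- by rewrite sqr_jump_size ?(ltW a0) ?(ltW x0).
- by rewrite subr_ge0.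
Unshelve. all: by end_near. Qed.

(** ** Rates of logarithmic order *)

Lemma harmonic_le_ln n : (0 < n)%N -> \sum_(j < n) (j.+1%:R^-1 : R) <= 1 + ln n%:R.
Proof.
elim: n => // -[|n] IH _; first by rewrite big_ord_recl big_ord0 ln1 invr1.
rewrite big_ord_recr /=; apply: le_trans (lerD (IH isT) (lexx _)) _.
rewrite -addrA lerD2l.
have inv_lt1 : (n.+2%:R : R)^-1 < 1 by rewrite invf_lt1// ltr1n.
have nE : n.+1%:R = (1 + - n.+2%:R^-1) * n.+2%:R :> R.
  by rewrite mulrDl mul1r mulNr mulVf ?gt_eqF// -[in RHS]natr1 addrK.
rewrite nE lnM ?posrE ?subr_gt0//.
have : ln (1 + - (n.+2%:R^-1 : R)) <= - n.+2%:R^-1 by apply: le_ln1Dx; rewrite ltrN2.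
by rewrite addrAC -lerBrDr subrr -lerBrDr sub0r.
Qed.

Lemma sum_positive_until_le n : (0 < n)%N ->
  \sum_(j < n) pr P (positive_until X j) <= 1 + m2 / a ^+ 2 * (1 + ln n%:R).
Proof.
have m2a : 0 <= m2 / a ^+ 2 by rewrite divr_ge0 ?sqr_ge0// second_moment_ge0.
case: n => // n _; rewrite big_ord_recl; apply: lerD.
  by apply: pr_le1; exact: measurable_positive_until.
apply: (@le_trans _ _ (m2 / a ^+ 2 * \sum_(j < n) (j.+1%:R^-1))).
  by rewrite mulr_sumr; apply: ler_sum => j _; exact: pr_positive_until_le.
apply: ler_wpM2l => //; case: n => [|n]; first by rewrite big_ord0 ln1 addr0.
apply: le_trans (harmonic_le_ln (ltn0Sn n)) _.
by rewrite lerD2l ler_ln ?posrE// ler_nat.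
Qed.

Lemma near_ln_div_sqrt e : 0 < e -> \forall y \near +oo, ln y / Num.sqrt y <= e :> R.
Proof.
move=> e0; near=> y; have y0 : 0 < y by near: y; apply: nbhs_pinfty_gt; exact: num_real.
have ry : 4 / e <= y `^ 4^-1 by near: y; exact: near_powR_ge.
set r := y `^ 4^-1 in ry; have r0 : 0 < r by exact: powR_gt0.
have ln_y : ln y <= 4 * r.
  by have : ln r < r by [exact: ln_sublinear]; rewrite ln_powR; lra.
rewrite -root4_sqr ?(ltW y0)// -/r ler_pdivrMr ?exprn_gt0//.
apply: le_trans ln_y _; rewrite expr2 mulrA ler_wpM2r ?(ltW r0)//.
by rewrite mulrC -ler_pdivrMr.
Unshelve. all: by end_near. Qed.

Lemma near_log_tilt m k M e1 e2 : 0 <= m -> 0 <= k -> 0 < M -> 0 < e1 -> 0 < e2 ->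
  \forall y \near +oo, (m + k * Num.sqrt y) * (M * ln y / y) <= e1 /\ M * ln y / y <= e2 :> R.
Proof.
move=> m0 k0 M0 e10 e20; pose c := (m + k + 1) * M.
have c0 : 0 < c by rewrite mulr_gt0 ?ltr_wpDl ?addr_ge0.
have e0 : 0 < Num.min e1 e2 / c by rewrite divr_gt0// lt_min e10.
near=> y; have y1 : 1 <= y by near: y; apply: nbhs_pinfty_ge; exact: num_real.
have : ln y / Num.sqrt y <= Num.min e1 e2 / c by near: y; exact: near_ln_div_sqrt.
rewrite ler_pdivlMr// le_min; have y0 : 0 < y by exact: lt_le_trans y1.
set r := Num.sqrt y; have r0 : 0 < r by rewrite sqrtr_gt0.
have r1 : 1 <= r by rewrite -sqrtr1 ler_wsqrtr.
have yE : y = r ^+ 2 by rewrite sqr_sqrtr// ltW.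
have q0 : 0 <= M * (ln y / r) by rewrite mulr_ge0 ?divr_ge0 ?ln_ge0 ?(ltW M0) ?(ltW r0).
have -> : M * ln y / y = M * (ln y / r) / r by rewrite [X in _ / X]yE; field; rewrite gt_eqF.
have -> : ln y / r * c = (m + k + 1) * (M * (ln y / r)) by rewrite /c; ring.
move: (M * (ln y / r)) q0 => q q0 /andP[q1 q2]; split.
  apply: le_trans q1; have -> : (m + k * r) * (q / r) = (m / r + k) * q.
    by field; rewrite gt_eqF.
  have : m / r <= m by rewrite ler_pdivrMr// ler_peMr.
  by move=> mr; apply: ler_wpM2r => //; lra.
apply: le_trans (_ : q <= _); first by rewrite ler_pdivrMr// ler_peMr.
by apply: le_trans q2; rewrite ler_peMl//; lra.
Unshelve. all: by end_near. Qed.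

Lemma sqrt_scaled_ge (x u v e : R) : 0 <= x -> 0 <= 1 - e ->
  (1 - e) * x <= u -> (1 - e) * (a / 2) <= v ->
  (1 - e) * jump_size a x <= 2 * Num.sqrt (u * v).
Proof.
move=> x0 e0 xu av; have a_ge0 := ltW a0.
have -> : (1 - e) * jump_size a x = 2 * Num.sqrt (((1 - e) * x) * ((1 - e) * (a / 2))).
  have -> : (1 - e) * x * ((1 - e) * (a / 2)) = ((1 - e) / 2) ^+ 2 * (2 * a * x) by field.
  rewrite sqrtrM ?sqr_ge0// sqrtr_sqr ger0_norm ?divr_ge0//.
  by rewrite mulrA [2 * _]mulrC divfK.
rewrite ler_wpM2l// ler_wsqrtr//; apply: ler_pM => //; first exact: mulr_ge0.
by rewrite mulr_ge0// divr_ge0.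
Qed.

(** [n] times at height [h] collect a negligible area, and so does a window of [W] times. *)
Lemma jump_parameters (x dl h : R) L : 0 < x -> 0 < dl -> 12 * dl <= 1 ->
  L%:R * dl = 1 -> h = dl * jump_size a x -> a <= h ->
  exists n W, [/\ (0 < n)%N /\ (0 < W)%N, 2 * h / a <= n%:R <= 4 * h / a, n%:R * h <= x,
    (1 - dl) * x <= x - n%:R * h - a * W%:R ^+ 2 / 2 &
    2 * jump_size a x / a <= (2 * L * W)%:R <= 4 / a * jump_size a x].
Proof.
move=> x0 dl0 dl12 Ldl hE ah; have a_gt0 := a0.
have y2 := sqr_jump_size (ltW a0) (ltW x0).
have Lh : L%:R * h = jump_size a x by rewrite hE mulrA Ldl mul1r.
have h0 : 0 < h by lra.
have ha_ge1 : 1 <= h / a by rewrite ler_pdivlMr// mul1r.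
have ha0 : 0 <= h / a by lra.
have /andP[n_ge n_le1] : 2 * (h / a) <= (Num.truncn (2 * (h / a))).+1%:R <= 2 * (h / a) + 1.
  by apply: truncnS_itv; rewrite mulr_ge0.
have /andP[W_ge W_le1] := truncnS_itv ha0.
exists (Num.truncn (2 * (h / a))).+1, (Num.truncn (h / a)).+1.
move: (Num.truncn (2 * (h / a))) (Num.truncn (h / a)) n_ge n_le1 W_ge W_le1 => n W.
move=> n_ge n_le1 W_ge W_le1.
have hx : h ^+ 2 / a = 2 * dl ^+ 2 * x by rewrite hE exprMn y2; field; rewrite gt_eqF.
have nh : n.+1%:R * h <= 8 * dl ^+ 2 * x.
  have n_le : n.+1%:R <= 4 * (h / a) by lra.
  by apply: le_trans (ler_wpM2r (ltW h0) n_le) _; lra.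
have W_le : W.+1%:R <= 2 * (h / a) by lra.
have aW : a * W.+1%:R ^+ 2 / 2 <= 4 * dl ^+ 2 * x.
  have : W.+1%:R ^+ 2 <= (2 * (h / a)) ^+ 2 by rewrite ler_pXn2r ?nnegrE// mulr_ge0.
  move=> /(ler_wpM2l (ltW a0)).
  have -> : a * (2 * (h / a)) ^+ 2 = 4 * (h ^+ 2 / a) by field; rewrite gt_eqF.
  by rewrite hx; lra.
have dlx : 12 * dl ^+ 2 * x <= dl * x.
  by rewrite ler_wpM2r ?(ltW x0)// expr2 mulrA -[leRHS]mul1r ler_wpM2r// ltW.
have dlx1 : dl * x <= x by rewrite ler_piMl ?(ltW x0)//; lra.
split=> //.
- by apply/andP; split; lra.
- by lra.
- by lra.
- rewrite !natrM -Lh.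
  have -> : 2 * (L%:R * h) / a = 2 * L%:R * (h / a) by ring.
  have -> : 4 / a * (L%:R * h) = 2 * L%:R * (2 * (h / a)) by ring.
  by rewrite !ler_wpM2l// mulr_ge0.
Qed.

Section LogarithmicRate.
Variables (K dl : R) (L : nat).
Hypotheses (K_ge0 : 0 <= K) (dl_gt0 : 0 < dl) (dl_small : 12 * dl <= 1) (Ldl : L%:R * dl = 1).

(** With the tilt [low_tilt * ln y / y], a height [dl * y] costs the factor [y ^ - (K + 2)], while
    jumps up to [low_jump * y] only contribute a factor [sqrt y] to the exponential moments. *)
Let low_tilt := (K + 2) / dl.
Let low_jump := dl / (2 * (K + 2)).

Let K2_gt0 : 0 < K + 2. Proof. exact: ltr_wpDl. Qed.

Let low_tilt_gt0 : 0 < low_tilt. Proof. by rewrite divr_gt0 ?K2_gt0. Qed.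

Let low_jump_gt0 : 0 < low_jump. Proof. by rewrite divr_gt0// mulr_gt0. Qed.

Let low_jump_le1 : low_jump <= 1.
Proof.
by have dl12 := dl_small; have K0 := K_ge0; rewrite ler_pdivrMr ?mulr_gt0//; lra.
Qed.

Lemma near_pr_without_jump : \forall y \near +oo, forall n, 2 * (dl * y) / a <= n%:R ->
  pr P (high_without_jump X (dl * y) (low_jump * y) n) <= expR (- ((K + 2) * ln y)) /\
  pr P (positive_without_jump X 0 (low_jump * y) n) <= expR (- ((K + 2) * ln y)).
Proof.
have m20 : 0 <= 2 * m2 by rewrite mulr_ge0// second_moment_ge0.
have a2_gt0 : 0 < a / 2 by rewrite divr_gt0.
have t0V_gt0 : 0 < t0^-1 by rewrite invr_gt0.
near=> y => n yn.
have y1 : 1 <= y by near: y; apply: nbhs_pinfty_ge; exact: num_real.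
have [tilt_a tilt_t0] : (2 * m2 + 2 * expR 1 * 2 * Num.sqrt y) * (low_tilt * ln y / y) <= a / 2 /\
    low_tilt * ln y / y <= t0^-1 by near: y; exact: near_log_tilt.
have y0 : 0 < y by exact: lt_le_trans y1.
set lam := low_tilt * ln y / y in tilt_a tilt_t0.
have lam0 : 0 <= lam by rewrite divr_ge0 ?(ltW y0)// mulr_ge0 ?(ltW low_tilt_gt0)// ln_ge0.
have lam_h : lam * (dl * y) = (K + 2) * ln y by rewrite /lam /low_tilt; field; rewrite !gt_eqF.
have lam_b : expR (lam * (low_jump * y)) = Num.sqrt y.
  have -> : lam * (low_jump * y) = ln y / 2.
    by rewrite /lam /low_tilt /low_jump; field; rewrite !gt_eqF.
  by rewrite -powR12_sqrt ?(ltW y0)// /powR gt_eqF// mulrC.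
have lam_itv : 0 <= lam <= t0^-1 by rewrite lam0.
have := truncated_mgf_bound_low (low_jump * y) lam_itv; rewrite lam_b.
move: tilt_a; rewrite -mulrA; set C := 2 * m2 + _ => tilt_a mgf.
have C0 : 0 <= C by rewrite addr_ge0// !mulr_ge0 ?expR_ge0 ?sqrtr_ge0.
have Clam : C * lam <= a by lra.
rewrite -lam_h; split; first by apply: pr_high_without_jump mgf _ _ _ => //; exact: iidX.1.
apply: le_trans (pr_positive_without_jump 0 n iidX.1 mgf C0 lam0 Clam) _.
rewrite ler_expR sub0r mulrN lerN2 ler_wpM2l//.
by apply: le_drift_mul yn => //; [rewrite mulr_ge0 ?ltW|rewrite subr_ge0].
Unshelve. all: by end_near. Qed.

Lemma pr_large_area_after_jump x h n W j l : let y := jump_size a x in let lam := g y / y in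
  0 < x -> h = dl * y -> a <= h -> (0 < W)%N -> t0 <= y -> 8 / a <= y -> lam <= t0^-1 ->
  mgf_const * lam <= dl * (a / 2) ->
  (1 - dl) * x <= x - n%:R * h - a * W%:R ^+ 2 / 2 ->
  2 * y / a <= (2 * L * W)%:R <= 4 / a * y ->
  pr P (large_area (shifted X j.+1) (l.+2%:R * h) (x - n%:R * h) (2 * L * W)) <=
  expR (- g y) + (2 * L%:R + 1) * expR (- (lam * ((1 - 2 * dl) * y - l.+2%:R * h))).
Proof.
move=> y lam x0 hE ah W0 t0y ay lam_t0 lam_dl xW /andP[nlow nup].
have a_gt0 := a0; have dl0 := dl_gt0; have dl12 := dl_small.
have y0 : 0 < y by exact: lt_le_trans t0y.
have lam0 : 0 <= lam by rewrite divr_ge0 ?(rate_ge0 g_decr g_lim) ?ltW.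
have dl1 : 0 <= 1 - dl by lra.
have slack : (1 - dl) * (a / 2) <= a / 2 - mgf_const * lam by lra.
have slack0 : 0 <= a / 2 - mgf_const * lam.
  by apply: le_trans slack; rewrite mulr_ge0// divr_ge0// ltW.
have xW0 : 0 <= x - n%:R * h - a * W%:R ^+ 2 / 2.
  by apply: le_trans xW; rewrite mulr_ge0 ?(ltW x0).
have jumpF i : pr P (jump (shifted X j.+1) y i) <= Fbar X y by rewrite (pr_jump _ _ iidX.2).
have mgf := truncated_mgf_bound_shifted j.+1 (truncated_mgf_bound_rate y0 lam_t0).
apply: le_trans (pr_large_area (l.+2%:R * h) (2 * L) (shift_independent j.+1 iidX.1) mgf jumpF
  a0 (ltW mgf_const_gt0) lam0 slack0 W0 xW0) _.
apply: lerD.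
  by apply: natmul_Fbar_le nup _ => //; lra.
rewrite (mulrDl (2 * L%:R) 1) mul1r natrM; apply: lerD.
  rewrite ler_wpM2l ?mulr_ge0// ler_expR lerN2 ler_wpM2l//.
  have := sqrt_scaled_ge (ltW x0) dl1 xW slack; rewrite -/y.
  by have : a / 2 <= dl * y by [rewrite -hE; lra]; lra.
have drift := le_drift_mul (ltW y0) slack0 nlow.
rewrite ler_expR -[leRHS]mulrN ler_wpM2l// opprB lerD2l lerN2; apply: le_trans drift.
by rewrite -[leRHS]mul1r ler_wpM2r ?(ltW y0)//; lra.
Qed.

Lemma sum_jump_levels_le y b h : t0 <= b -> b <= y -> h = dl * y ->
  \sum_(l < L) Fbar X (Num.max (l%:R * h) b) * (expR (- g y) +
     (2 * L%:R + 1) * expR (- (g y / y * ((1 - 2 * dl) * y - l.+2%:R * h)))) <=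
  L%:R * ((2 * L%:R + 2) * (2 * b ^- 2)) * expR (- ((1 - 4 * dl) * g y)).
Proof.
move=> t0b by_ hE; set E := expR (- ((1 - 4 * dl) * g y)); have dl0 := dl_gt0.
have b0 : 0 < b by exact: lt_le_trans t0b.
have y0 : 0 < y by exact: lt_le_trans by_.
have gE : expR (- g y) <= E.
  have gy0 : 0 <= g y by exact: rate_ge0 g_lim _ _.
  by rewrite ler_expR lerN2 -[leRHS]mul1r ler_wpM2r//; lra.
have -> : L%:R * ((2 * L%:R + 2) * (2 * b ^- 2)) * E =
    \sum_(l < L) ((2 * L%:R + 2) * (2 * b ^- 2) * E).
  by rewrite sumr_const card_ord -[RHS]mulr_natl -[LHS]mulrA.
apply: ler_sum => l _.
have -> : expR (- (g y / y * ((1 - 2 * dl) * y - l.+2%:R * h))) =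
    expR (g y / y * (l%:R * h)) * E.
  by rewrite -expRD; congr expR; rewrite hE -!natr1; field; rewrite gt_eqF.
set t := Num.max _ _; have bt : b <= t by rewrite le_max lexx orbT.
have t_gt0 : 0 < t by exact: lt_le_trans bt.
have ty : t <= y.
  rewrite ge_max by_ andbT hE mulrA.
  apply: (@le_trans _ _ (L%:R * dl * y)); last by rewrite Ldl mul1r.
  by rewrite ler_wpM2r ?(ltW y0)// ler_wpM2r ?(ltW dl0)// ler_nat ltnW.
have tilted u : u <= t -> Fbar X t * expR (g y / y * u) <= 2 * b ^- 2.
  move=> ut; rewrite mulrC.
  apply: le_trans (ler_wpM2l (expR_ge0 _) (Fbar_le_tail (le_trans t0b bt))) _.
  rewrite mulrCA ler_wpM2l//.
  apply: le_trans (tilted_tail_model_le g_decr g_lim t_gt0 ty ut) _.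
  by rewrite lef_pV2 ?posrE ?exprn_gt0// ler_pXn2r ?nnegrE ?(ltW b0) ?(ltW t_gt0).
have untilted : Fbar X t <= 2 * b ^- 2.
  by have := tilted 0 (ltW t_gt0); rewrite mulr0 expR0 mulr1.
have small_part : Fbar X t * expR (- g y) <= 2 * b ^- 2 * E.
  by apply: ler_pM; rewrite ?Fbar_ge0 ?expR_ge0.
have : (2 * L%:R + 1) * E * (Fbar X t * expR (g y / y * (l%:R * h))) <=
    (2 * L%:R + 1) * E * (2 * b ^- 2).
  by rewrite ler_wpM2l ?tilted ?le_max ?lexx// mulr_ge0 ?expR_ge0// addr_ge0// mulr_ge0.
move: small_part; move: (Fbar X t) (expR (- g y)) (expR (g y / y * (l%:R * h))) (b ^- 2).
by move=> F A G B; lra.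
Qed.

Let level_const := L%:R * ((2 * L%:R + 2) * (2 * low_jump ^- 2)).
Let duration_const := 1 + 2 * (m2 / a ^+ 2).

Definition log_case_const : R := 2 + duration_const * (2 + level_const).

Let level_const_ge0 : 0 <= level_const.
Proof.
rewrite /level_const mulr_ge0// mulr_ge0 ?addr_ge0 ?mulr_ge0//.
by rewrite invr_ge0 exprn_ge0// ltW.
Qed.

Let duration_const_ge1 : 1 <= duration_const.
Proof. by rewrite lerDl mulr_ge0 ?divr_ge0 ?sqr_ge0// second_moment_ge0. Qed.

Lemma log_case_const_gt0 : 0 < log_case_const.
Proof.
by rewrite ltr_wpDr// mulr_ge0 ?(le_trans ler01 duration_const_ge1)// addr_ge0 ?level_const_ge0.
Qed.

Lemma sum_positive_until_log y n : 0 < y -> 8 / a <= y -> (0 < n)%N ->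
  n%:R <= 4 * (dl * y) / a -> \sum_(j < n) pr P (positive_until X j) <= duration_const * (1 + ln y).
Proof.
move=> y0 ay n0 ny; have dl12 := dl_small.
have m2a : 0 <= m2 / a ^+ 2 by rewrite divr_ge0 ?sqr_ge0// second_moment_ge0.
have n_le : n%:R <= y ^+ 2.
  apply: le_trans ny _; apply: (@le_trans _ _ (8 / a * y)); last first.
    by rewrite expr2 ler_wpM2r// ltW.
  have -> : 4 * (dl * y) / a = 4 * dl * (y / a) by ring.
  have -> : 8 / a * y = 8 * (y / a) by ring.
  by rewrite ler_wpM2r ?divr_ge0 ?ltW//; lra.
have ln_n : ln n%:R <= 2 * ln y.
  by rewrite mulr_natl -lnXn// ler_ln ?posrE ?exprn_gt0 ?ltr0n.
have ln_n0 : 0 <= ln n%:R :> R by rewrite ln_ge0// ler1n.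
apply: le_trans (sum_positive_until_le n0) _.
have := ler_wpM2l m2a ln_n; have : 0 <= m2 / a ^+ 2 * ln y by rewrite mulr_ge0//; lra.
by rewrite /duration_const; lra.
Qed.

Lemma PAtau_gt_le_log x : let y := jump_size a x in let lam := g y / y in
  1 <= x -> 1 <= y -> t0 <= low_jump * y -> a <= dl * y -> 8 / a <= y -> lam <= t0^-1 ->
  mgf_const * lam <= dl * (a / 2) -> g y <= K * ln y ->
  (forall n, 2 * (dl * y) / a <= n%:R ->
    pr P (high_without_jump X (dl * y) (low_jump * y) n) <= expR (- ((K + 2) * ln y)) /\
    pr P (positive_without_jump X 0 (low_jump * y) n) <= expR (- ((K + 2) * ln y))) ->
  PAtau_gt X x <=
    log_case_const * (1 + ln y) * (y ^- 2 * expR (- ((1 - 4 * dl) * g y))).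
Proof.
move=> y lam x1 y1 t0b ah ay lam_t0 lam_dl gK no_jump_small; have dl0 := dl_gt0.
have x0 : 0 < x by exact: lt_le_trans x1.
have y0 : 0 < y by exact: lt_le_trans y1.
have gy0 : 0 <= g y by exact: rate_ge0 g_lim _ _.
have ly0 : 0 <= ln y by exact: ln_ge0.
have by_ : low_jump * y <= y by rewrite ler_piMl ?(ltW y0) ?low_jump_le1.
have t0y : t0 <= y by exact: le_trans by_.
have yL : y <= L%:R * (dl * y) by rewrite mulrA Ldl mul1r.
have [n [W [[n0 W0] /andP[nlow nup] nx xW Wy]]] := jump_parameters x0 dl0 dl_small Ldl erefl ah.
set E := expR (- ((1 - 4 * dl) * g y)); set r := y ^- 2 * E.
have r0 : 0 <= r by rewrite mulr_ge0 ?expR_ge0// invr_ge0 exprn_ge0// ltW.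
have model_r : tail_model g y <= r.
  rewrite /tail_model mulrC ler_wpM2l ?invr_ge0 ?exprn_ge0 ?(ltW y0)//.
  by rewrite ler_expR lerN2 -[leRHS]mul1r ler_wpM2r//; lra.
have no_jump_r : expR (- ((K + 2) * ln y)) <= r.
  apply: le_trans model_r; rewrite mulrDl opprD expRD ler_pM ?expR_ge0//.
    by rewrite ler_expR lerN2.
  by rewrite expRN mulr_natl -lnXn// lnK// posrE exprn_gt0.
have [high_r pos_r] := no_jump_small n nlow.
apply: le_trans (PAtau_gt_le (y := y) (L := L) iidX _ _ n0 nx yL (le_trans high_r no_jump_r)
  (le_trans pos_r no_jump_r) (fun j l _ => pr_large_area_after_jump j l x0 erefl ah W0 t0y ay
    lam_t0 lam_dl xW Wy)) _; try by rewrite mulr_gt0.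
have Fr : Fbar X y <= 2 * r by apply: le_trans (Fbar_le_tail t0y) _; rewrite ler_wpM2l.
have levels := sum_jump_levels_le t0b by_ erefl.
have level_r : L%:R * ((2 * L%:R + 2) * (2 * (low_jump * y) ^- 2)) * E = level_const * r.
  by rewrite /level_const /r; field; rewrite !gt_eqF.
have durations := sum_positive_until_log y0 ay n0 nup.
have := lerD Fr levels; rewrite level_r -mulrDl => jump_r.
have D0 : 0 <= \sum_(j < n) pr P (positive_until X j) by apply: sumr_ge0 => j _; exact: pr_ge0.
have rest0 : 0 <= (2 + level_const) * r by rewrite mulr_ge0// addr_ge0.
have := le_trans (ler_wpM2l D0 jump_r) (ler_wpM2r rest0 durations).
have : 0 <= ln y * r by rewrite mulr_ge0.
by rewrite /log_case_const; lra.
Qed.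

Lemma area_tail_log_case : \forall x \near +oo, g (jump_size a x) <= K * ln (jump_size a x) ->
  PAtau_gt X x <= log_case_const * (1 + ln (jump_size a x)) *
    (jump_size a x ^- 2 * expR (- ((1 - 4 * dl) * g (jump_size a x)))).
Proof.
have mgf0 := mgf_const_gt0.
have t0V_gt0 : 0 < t0^-1 by rewrite invr_gt0.
have slack_gt0 : 0 < dl * (a / 2) / mgf_const by rewrite divr_gt0 ?mulr_gt0 ?divr_gt0.
near=> x; set y := jump_size a x => gK.
have y1 : 1 <= y by rewrite /y; near: x; exact: near_jump_size_ge.
have t0b : t0 / low_jump <= y by rewrite /y; near: x; exact: near_jump_size_ge.
have ah : a / dl <= y by rewrite /y; near: x; exact: near_jump_size_ge.
have ay : 8 / a <= y by rewrite /y; near: x; exact: near_jump_size_ge.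
have lam_t0 : g y / y <= t0^-1.
  by rewrite /y; near: x; exact: near_jump_size a0 (near_rate_le g_lim t0V_gt0).
have lam_dl : g y / y <= dl * (a / 2) / mgf_const.
  by rewrite /y; near: x; exact: near_jump_size a0 (near_rate_le g_lim slack_gt0).
apply: PAtau_gt_le_log => //.
- by rewrite mulrC -ler_pdivrMr.
- by rewrite mulrC -ler_pdivrMr.
- by rewrite mulrC -ler_pdivlMr.
- by near: x; exact: near_jump_size a0 near_pr_without_jump.
Unshelve. all: by end_near. Qed.

End LogarithmicRate.

(** ** Logarithmic asymptotics *)

Lemma near_powR_le_jump_size p e : p < 2^-1 -> 0 < e ->
  \forall x \near +oo, x `^ p <= e * jump_size a x.
Proof.
move=> p_half e0; have es0 : 0 < e * scale by rewrite mulr_gt0.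
have p_gap : 0 < 2^-1 - p by rewrite subr_gt0.
near=> x; have x0 : 0 < x by near: x; apply: nbhs_pinfty_gt; exact: num_real.
have gap : (e * scale)^-1 <= x `^ (2^-1 - p) by near: x; exact: near_powR_ge.
rewrite jump_sizeE ?(ltW a0)// -/scale -powR12_sqrt ?(ltW x0)//.
rewrite -[2^-1 in leRHS](subrKC p) powRD; last by apply/implyP => _; rewrite gt_eqF.
rewrite mulrA mulrCA; apply: ler_peMr; first exact: powR_ge0.
by move: gap; rewrite -div1r ler_pdivrMr// mulrC.
Unshelve. all: by end_near. Qed.

Lemma rate_stretch y z e : 0 < y -> y <= z <= (1 + e) * y -> g z <= (1 + e) * g y.
Proof.
move=> y0 /andP[yz zy]; have gy0 : 0 <= g y by exact: rate_ge0 g_lim _ _.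
have z0 : 0 < z by exact: lt_le_trans yz.
apply: (@le_trans _ _ (z / y * g y)); last by rewrite ler_wpM2r// ler_pdivrMr.
have := g_decr y0 yz; rewrite ler_pdivrMr// => /le_trans; apply.
by apply: eq_implies_le; ring.
Qed.

Lemma ln_stretch (y z e : R) : 0 < y -> 0 < z -> z <= (1 + e) * y -> ln z <= ln y + e.
Proof.
move=> y0 z0 zy; have zE : z = (1 + (z / y - 1)) * y by field; rewrite gt_eqF.
have zy0 : 0 < z / y by exact: divr_gt0.
rewrite {1}zE lnM ?posrE//; last by rewrite addrC subrK.
rewrite addrC lerD2l; apply: le_trans (le_ln1Dx _) _; first by lra.
by rewrite lerBlDl ler_pdivrMr.
Qed.

Lemma ln_Fbar_itv y : t0 <= y ->
  g y + 2 * ln y - ln 2 <= - ln (Fbar X y) <= g y + 2 * ln y + ln 2.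
Proof.
move=> t0y; have y0 : 0 < y by exact: lt_le_trans t0y.
have F0 := Fbar_gt0 t0y; have model0 := tail_model_gt0 g y0.
have /andP[Flow Fup] := Fbar_tail t0y.
have up : ln (Fbar X y) <= ln 2 - g y - 2 * ln y.
  by rewrite -ln_tail_model// ler_ln ?posrE// mulr_gt0.
have : ln (2^-1 * tail_model g y) <= ln (Fbar X y).
  have half0 : 0 < 2^-1 * tail_model g y by rewrite mulr_gt0.
  by rewrite ler_ln ?posrE// [leLHS]mulrC.
by rewrite ln_tail_model// lnV ?posrE// => low; apply/andP; split; lra.
Qed.

Lemma near_ln_area_tail_le e : 0 < e -> \forall x \near +oo, 0 < PAtau_gt X x /\
  - ln (PAtau_gt X x) <= (1 + e) * - ln (Fbar X (jump_size a x)).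
Proof.
move=> e0.
have quarter_e : 0 < e / 4 by rewrite divr_gt0.
have eps0 : (0 : R) < 8^-1 by rewrite invr_gt0.
have p_half : 4^-1 + 8^-1 < 2^-1 :> R by lra.
have half_lt : 2^-1 < \sum_(k < 1) pr P (positive_until X k).
  rewrite big_ord1 (_ : positive_until X 0 = setT); last by apply/seteqP; split.
  by rewrite pr_setT invf_lt1// ltr1n.
near=> x; have x0 : 0 < x by near: x; apply: nbhs_pinfty_gt; exact: num_real.
have low : 2^-1 <= PAtau_gt X x / Fbar X (jump_size a x + 2 * x `^ (4^-1 + 8^-1)).
  by near: x; exact: area_tail_lower eps0 half_lt.
have shift : x `^ (4^-1 + 8^-1) <= e / 4 * jump_size a x.
  by near: x; exact: near_powR_le_jump_size.
move: low shift; set y := jump_size a x; set q := x `^ _; set z := y + 2 * q => low shift.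
have t0y : t0 <= y by rewrite /y; near: x; exact: near_jump_size_ge.
have ln_y : (e + (3 + e) * ln 2) / (2 * e) <= ln y.
  by rewrite /y; near: x; exact: near_jump_size a0 (near_ln_ge _).
have y0 : 0 < y by exact: lt_le_trans t0y.
have yz : y <= z by rewrite lerDl mulr_ge0// powR_ge0.
have z0 : 0 < z by exact: lt_le_trans yz.
have zy : z <= (1 + e / 2) * y by rewrite /z; lra.
have t0z := le_trans t0y yz; have Fz0 := Fbar_gt0 t0z.
move: low; rewrite ler_pdivlMr// => low.
have half_Fz0 : 0 < 2^-1 * Fbar X z by rewrite mulr_gt0.
have PA0 : 0 < PAtau_gt X x by exact: lt_le_trans low; split=> //.
have : ln (2^-1 * Fbar X z) <= ln (PAtau_gt X x) by rewrite ler_ln.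
rewrite lnM ?posrE// lnV ?posrE//.
have /andP[Fy_low _] := ln_Fbar_itv t0y; have /andP[_ Fz_up] := ln_Fbar_itv t0z.
have yzy : y <= z <= (1 + e / 2) * y by rewrite yz.
have := rate_stretch y0 yzy; have := ln_stretch y0 z0 zy.
have := ler_wpM2l (addr_ge0 ler01 (ltW e0)) Fy_low.
have : 0 <= e * g y by rewrite mulr_ge0 ?(ltW e0)//; exact: rate_ge0 g_lim _ _.
move: ln_y; rewrite ler_pdivrMr ?mulr_gt0//; lra.
Unshelve. all: by end_near. Qed.

Lemma ln_le_of_log_case (e dl C p y : R) : 0 < e -> 4 * dl <= e -> 0 < C -> 0 < p -> 1 <= y ->
  0 <= g y -> p <= C * (1 + ln y) * (y ^- 2 * expR (- ((1 - 4 * dl) * g y))) ->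
  (1 - e) * (g y + 2 * ln y) + e * ln y - (ln C + e - ln e) <= - ln p.
Proof.
move=> e0 dle C0 p0 y1 gy0 p_le; have y0 : 0 < y by exact: lt_le_trans y1.
have ly0 : 0 < 1 + ln y by rewrite ltr_wpDr// ln_ge0.
have ln_p : ln p <= ln (C * (1 + ln y) * (expR (- ((1 - 4 * dl) * g y)) * y ^- 2)).
  by rewrite ler_ln ?posrE// 1?[expR _ * _]mulrC// (lt_le_trans p0).
move: ln_p; rewrite ln_tail_model ?mulr_gt0// lnM ?posrE//.
have : ln (e * (1 + ln y)) < e * (1 + ln y) by apply: ln_sublinear; rewrite mulr_gt0.
rewrite lnM ?posrE//; have : 4 * dl * g y <= e * g y by rewrite ler_wpM2r.
lra.
Qed.

Lemma ln_le_of_linear_case (e C p x : R) : let y := jump_size a x in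
  0 < e -> 0 < C -> 0 < p -> 0 < x -> 0 < y -> 0 <= g y -> 4 * ln y <= e * g y ->
  2 * C * g y / (a * y) <= e / 4 -> e <= 1 -> 0 <= ln y ->
  p <= C * x `^ 4^-1 * expR (- (g y * Num.sqrt (1 - 2 * C * g y / (a * y)))) ->
  (1 - e) * (g y + 2 * ln y) + ln y / 2 - (ln C - ln (2 * a) / 4) <= - ln p.
Proof.
move=> y e0 C0 p0 x0 y0 gy0 ly_g; set t := _ / (a * y) => te e1 ly0 p_le.
have q0 : 0 < x `^ 4^-1 by exact: powR_gt0.
have : ln p <= ln (C * x `^ 4^-1 * expR (- (g y * Num.sqrt (1 - t)))).
  by rewrite ler_ln ?posrE// (lt_le_trans p0).
rewrite lnM ?posrE ?expR_gt0 ?mulr_gt0// lnM ?posrE// expRK ln_powR.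
have -> : ln x = 2 * ln y - ln (2 * a).
  have : ln (y ^+ 2) = ln (2 * a * x) by rewrite sqr_jump_size ?(ltW a0) ?(ltW x0).
  by rewrite lnXn// lnM ?posrE ?mulr_gt0// [2 * ln y]mulr_natl => ->; ring.
have t_ge0 : 0 <= t by rewrite divr_ge0 ?mulr_ge0 ?(ltW C0) ?(ltW a0) ?(ltW y0).
have sqrt_ge : 1 - t <= Num.sqrt (1 - t).
  have t1 : 0 <= 1 - t by lra.
  rewrite -{1}(sqr_sqrtr t1) expr2 ler_piMl ?sqrtr_ge0//.
  by rewrite -[leRHS]sqrtr1 ler_wsqrtr// lerBlDr lerDl.
have : g y * (1 - e / 4) <= g y * Num.sqrt (1 - t).
  by rewrite ler_wpM2l//; apply: le_trans sqrt_ge; lra.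
have : 0 <= e * ln y by rewrite mulr_ge0 ?(ltW e0).
lra.
Qed.

Lemma exists_nat_inverse (q : R) : 0 < q ->
  exists (L : nat) (dl : R), [/\ 0 < dl, L%:R * dl = 1 & q * dl <= 1].
Proof.
move=> q0; have /andP[qL _] := truncnS_itv (ltW q0); set L := (Num.truncn q).+1 in qL.
exists L, L%:R^-1; split; first by rewrite invr_gt0.
- by rewrite divff// gt_eqF.
- by rewrite ler_pdivrMr// mul1r.
Qed.

Lemma near_ln_area_tail_ge_log e : 0 < e -> \forall x \near +oo,
  0 < PAtau_gt X x -> g (jump_size a x) <= 4 / e * ln (jump_size a x) ->
  (1 - e) * (g (jump_size a x) + 2 * ln (jump_size a x) + ln 2) <= - ln (PAtau_gt X x).
Proof.
move=> e0; have K_gt0 : 0 < 4 / e by rewrite divr_gt0.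
have [|L [dl [dl0 Ldl q_dl]]] := @exists_nat_inverse (12 + 4 / e); first by lra.
have K_dl0 : 0 < 4 / e * dl by rewrite mulr_gt0.
have dl_small : 12 * dl <= 1 by lra.
have dl_e : 4 * dl <= e.
  by have : 4 / e * dl <= 1 by [lra]; rewrite mulrAC ler_pdivrMr// mul1r.
have K_ge0 := ltW K_gt0; have upper := area_tail_log_case K_ge0 dl0 dl_small Ldl.
have C0 : 0 < log_case_const (4 / e) dl L by exact: log_case_const_gt0.
set C := log_case_const _ _ _ in upper C0.
near=> x => PA0 gK; set y := jump_size a x in gK *.
have PA_le : PAtau_gt X x <= C * (1 + ln y) * (y ^- 2 * expR (- ((1 - 4 * dl) * g y))).
  by move: gK; rewrite /y; near: x.
have t0y : t0 <= y by rewrite /y; near: x; exact: near_jump_size_ge.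
have ln_y : (ln C + e - ln e + ln 2) / e <= ln y.
  by rewrite /y; near: x; exact: near_jump_size a0 (near_ln_ge _).
have y1 : 1 <= y by exact: le_trans t0y.
have gy0 : 0 <= g y by apply: rate_ge0 g_lim _ _ => //; exact: lt_le_trans y1.
have := ln_le_of_log_case e0 dl_e C0 PA0 y1 gy0 PA_le.
have : 0 <= e * ln 2 by rewrite mulr_ge0 ?(ltW e0)// ln_ge0// ler1n.
by move: ln_y; rewrite ler_pdivrMr//; lra.
Unshelve. all: by end_near. Qed.

Lemma near_ln_area_tail_ge_linear e : 0 < e -> e <= 1 -> \forall x \near +oo,
  0 < PAtau_gt X x -> 4 / e * ln (jump_size a x) < g (jump_size a x) ->
  (1 - e) * (g (jump_size a x) + 2 * ln (jump_size a x) + ln 2) <= - ln (PAtau_gt X x).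
Proof.
move=> e0 e1; have [C [C0 upper]] := area_tail_upper.
have rate_gt0 : 0 < a * e / (8 * C) by rewrite divr_gt0 ?mulr_gt0.
near=> x => PA0 gK; set y := jump_size a x in gK *.
have x0 : 0 < x by near: x; apply: nbhs_pinfty_gt; exact: num_real.
have PA_le : PAtau_gt X x <= C * x `^ 4^-1 *
    expR (- (g y * Num.sqrt (1 - 2 * C * g y / (a * y)))) by rewrite /y; near: x.
have t0y : t0 <= y by rewrite /y; near: x; exact: near_jump_size_ge.
have rate_y : g y / y <= a * e / (8 * C).
  by rewrite /y; near: x; exact: near_jump_size a0 (near_rate_le g_lim rate_gt0).
have ln_y : 2 * (ln C - ln (2 * a) / 4 + ln 2) <= ln y.
  by rewrite /y; near: x; exact: near_jump_size a0 (near_ln_ge _).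
have y1 : 1 <= y by exact: le_trans t0y.
have y0 : 0 < y by exact: lt_le_trans y1.
have gy0 : 0 <= g y by exact: rate_ge0 g_lim _ _.
have ly_g : 4 * ln y <= e * g y.
  by move: gK; rewrite mulrAC ltr_pdivrMr// => /ltW; rewrite [g y * e]mulrC.
have loss_le : 2 * C * g y / (a * y) <= e / 4.
  have -> : 2 * C * g y / (a * y) = 2 * C / a * (g y / y) by field; rewrite !gt_eqF.
  have -> : e / 4 = 2 * C / a * (a * e / (8 * C)) by field; rewrite !gt_eqF.
  by rewrite ler_wpM2l// divr_ge0 ?mulr_ge0 ?ltW.
have := ln_le_of_linear_case e0 C0 PA0 x0 y0 gy0 ly_g loss_le e1 (ln_ge0 y1) PA_le.
have : 0 <= e * ln 2 by rewrite mulr_ge0 ?(ltW e0)// ln_ge0// ler1n.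
lra.
Unshelve. all: by end_near. Qed.

(** Either [g y] exceeds [4 / e * ln y], and the factor [x ^ (1/4)] is absorbed by
    [e * g y], or the bound for rates of logarithmic order applies. *)
Lemma near_ln_area_tail_ge e : 0 < e -> e <= 1 -> \forall x \near +oo,
  0 < PAtau_gt X x -> (1 - e) * - ln (Fbar X (jump_size a x)) <= - ln (PAtau_gt X x).
Proof.
move=> e0 e1; near=> x => PA0; set y := jump_size a x.
have t0y : t0 <= y by rewrite /y; near: x; exact: near_jump_size_ge.
have /andP[_ lnF] := ln_Fbar_itv t0y.
apply: le_trans (_ : (1 - e) * (g y + 2 * ln y + ln 2) <= _).
  by rewrite ler_wpM2l// subr_ge0.
have [gK|gK] := leP (g y) (4 / e * ln y); move: PA0 gK; rewrite /y; near: x.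
  exact: near_ln_area_tail_ge_log.
exact: near_ln_area_tail_ge_linear.
Unshelve. all: by end_near. Qed.

Lemma ratio_close (p f e : R) : 0 < f -> (1 - e) * f <= p <= (1 + e) * f -> `|1 - p / f| <= e.
Proof.
move=> f0 /andP[low up]; have : 1 - e <= p / f by rewrite ler_pdivlMr.
have : p / f <= 1 + e by rewrite ler_pdivrMr.
by rewrite ler_norml => ratio_le ratio_ge; apply/andP; split; lra.
Qed.

Lemma ln_area_tail_ratio :
  (fun x => ln (PAtau_gt X x) / ln (Fbar X (jump_size a x))) @ +oo --> (1 : R).
Proof.
apply/cvgrPdist_le => e' e'0; pose e := Num.min e' 1.
have e0 : 0 < e by rewrite lt_min e'0 ltr01.
have e1 : e <= 1 by rewrite ge_min lexx orbT.
near=> x; set y := jump_size a x.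
have lower : 0 < PAtau_gt X x -> (1 - e) * - ln (Fbar X y) <= - ln (PAtau_gt X x).
  by rewrite /y; near: x; exact: near_ln_area_tail_ge.
have [PA0 upper] : 0 < PAtau_gt X x /\ - ln (PAtau_gt X x) <= (1 + e) * - ln (Fbar X y).
  by rewrite /y; near: x; exact: near_ln_area_tail_le.
have t0y : t0 <= y by rewrite /y; near: x; exact: near_jump_size_ge.
have ln_y : ln 2 + 1 <= ln y by rewrite /y; near: x; exact: near_jump_size a0 (near_ln_ge _).
have lnF0 : 0 < - ln (Fbar X y).
  have /andP[] := ln_Fbar_itv t0y; have : 0 <= ln 2 :> R by rewrite ln_ge0// ler1n.
  have : 0 <= g y by apply: rate_ge0 g_lim _ _ => //; exact: lt_le_trans t0y.
  lra.
rewrite -[_ / _]mulrNN -invrN; apply: le_trans (_ : e <= _); last by rewrite ge_min lexx.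
by apply: ratio_close => //; rewrite lower.
Unshelve. all: by end_near. Qed.

End Asymptotics.

Theorem theorem1 (d : measure_display) (T : measurableType d) (R : realType)
  (P : probability T R) (X : nat -> {RV P >-> R}) (a : R) (g : R -> R) :
  iid X ->
  0 < a ->
  P.-integrable setT (EFin \o X 0%N) ->
  ('E_P[X 0%N] = (- a)%:E)%E ->
  (X 0%N : T -> R) \in Lfun P 2%:E ->
  (* Fbar(x) ~ e^{-g(x)} x^{-2} *)
  (fun x => Fbar X x / (expR (- g x) * x ^- 2)) @ +oo --> (1:R) ->
  (* g continuously differentiable on (0, oo) *)
  (forall x, 0 < x -> derivable g x 1) ->
  {in `]0, +oo[, continuous (derive1 g)} ->
  (* g nondecreasing for all sufficiently large x *)
  (exists x0, forall x y, x0 <= x -> x <= y -> g x <= g y) ->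
  (* g(x)/x nonincreasing on (0, oo), tending to 0 *)
  (forall x y, 0 < x -> x <= y -> g y / y <= g x / x) ->
  (fun x => g x / x) @ +oo --> (0:R) ->
  [/\
   (* (i) *)
   (exists C, 0 < C /\
      \forall x \near +oo,
        PAtau_gt X x <=
          C * x `^ (4^-1) *
          expR (- (g (Num.sqrt (2 * a * x)) *
                   Num.sqrt (1 - 2 * C * g (Num.sqrt (2 * a * x))
                                   / (a * Num.sqrt (2 * a * x)))))),
   (* (ii) : liminf_{x -> oo} ratio >= E tau *)
   (forall eps, 0 < eps -> exists C, 0 < C /\
      forall c : R, (c%:E < Etau X)%E ->
        \forall x \near +oo,
          c <= PAtau_gt X x / Fbar X (Num.sqrt (2 * a * x) + C * x `^ (4^-1 + eps)))
   &
   (* (iii) *)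
   ((exists gamma0, 0 < gamma0 < 1 /\
       (forall x y, 0 < x -> x <= y -> g y / y `^ gamma0 <= g x / x `^ gamma0) /\
       (fun x => g x / x `^ gamma0) @ +oo --> (0:R)) ->
    (fun x => ln (PAtau_gt X x) / ln (Fbar X (Num.sqrt (2 * a * x)))) @ +oo --> (1:R))].
Proof.
move=> iidX a0 intX meanX /Lfun2_integrable_sqr intX2 tailX _ _ _ g_decr g_lim.
have model_pos : \forall t \near +oo, 0 < tail_model g t.
  by near=> t; apply: tail_model_gt0; near: t; apply: nbhs_pinfty_gt; exact: num_real.
have [t0 t0_ge1 tail] := near_pinfty_threshold 1 (asymp_two_sided model_pos tailX).
split.
- exact: (area_tail_upper iidX a0 intX meanX intX2 g_decr g_lim t0_ge1 tail).
- move=> eps eps0; exists 2; split=> // c /Etau_gt[K cK].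
  exact: (area_tail_lower iidX a0 intX meanX intX2 g_decr g_lim t0_ge1 tail eps0 cK).
- by move=> _; exact: (ln_area_tail_ratio iidX a0 intX meanX intX2 g_decr g_lim t0_ge1 tail).
Unshelve. all: by end_near. Qed.
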